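(* Let $H$ be a Hopf algebra over a field $K$ and let $H^{+}=\ker(\varepsilon)$ be the augmentation ideal. The following assertions are equivalent: (a) $H$ is formally smooth as an algebra in $\mathfrak{M}_{K}$. (b) $H$ is formally smooth as an algebra in $\mathfrak{M}^{H}$. (c) $H^{+}$ is projective in ${}_{H}\mathfrak{M}$. (d) There exists an $fs$-section $\tau:H^{+}\to H\otimes H^{+}$. (e) $H$ is a hereditary $K$-algebra. Moreover, if $H$ is finite dimensional, the following assertion is also equivalent to the others: (f) The multiplication $H^{+}\otimes H^{+}\to H^{+}$ has a left $H$-linear section, where $H^{+}\otimes H^{+}$ is a left $H$-module via the action on the first factor (left multiplication).
   Context: $\varepsilon$ is the counit of $H$; $\otimes=\otimes_K$. $\mathfrak{M}_K$ is the monoidal category of $K$-vector spaces; $\mathfrak{M}^H$ is the monoidal category of right $H$-comodules with $\otimes_K$ (codiagonal coaction) and unit $K$; $H$ is an algebra in $\mathfrak{M}^H$ via its comultiplication. ${}_H\mathfrak{M}$ is the category of left $H$-modules. For an algebra $(A,m,u)$ in an abelian monoidal category $\mathcal{M}$ (abelian, with $X\otimes-$ and $-\otimes X$ additive and right exact for all $X$), let $\Omega^1A=\ker m$, an object of the category ${}_A\mathcal{M}_A$ of $A$-bimodules in $\mathcal{M}$, and let ${}_A\mathcal{E}_A$ be the class of morphisms in ${}_A\mathcal{M}_A$ having a section (right inverse) in $\mathcal{M}$. $A$ is formally smooth in $\mathcal{M}$ if $\Omega^1A$ is ${}_A\mathcal{E}_A$-projective, i.e. for every $f:X\to Y$ in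 ${}_A\mathcal{E}_A$ every morphism $\Omega^1A\to Y$ in ${}_A\mathcal{M}_A$ factors through $f$. An $fs$-section is a $K$-linear map $\tau:H^{+}\to H\otimes H^{+}$ such that, writing $\tau(x)=\sum_i a_i\otimes b_i$, for all $h\in H$, $x\in H^{+}$: (i) $\tau(hx)=\sum_i ha_i\otimes b_i$; (ii) $\sum_i a_ib_i=x$. Hereditary algebra: every (left) submodule of a projective (left) module is projective. *)

(* Defs.v *)
From HB Require Import structures.
From mathcomp Require Import all_boot all_algebra.
From mathcomp Require Import boolp.

Set Implicit Arguments.
Unset Strict Implicit.
Unset Printing Implicit Defensive.

Import GRing.Theory.
Local Open Scope ring_scope.
Local Open Scope quotient_scope.

Notation bilin f := (bilinear_for *:%R *:%R f).

(* The tensor product over K: the quotient of the formal sums of pairs by the relation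
   "identified by every bilinear map". *)
Section TensorDef.
Variables (K : fieldType) (U V : lmodType K).

Definition tsum (W : lmodType K) (f : U -> V -> W) (s : seq (U * V)) : W :=
  \sum_(p <- s) f p.1 p.2.

Definition tens_eq (s t : seq (U * V)) : Prop :=
  forall (W : lmodType K) (f : U -> V -> W), bilin f -> tsum f s = tsum f t.

Definition tens_eqb (s t : seq (U * V)) : bool := `[< tens_eq s t >].

Lemma tens_eqb_refl : reflexive tens_eqb.
Proof. by move=> s; apply/asboolP. Qed.

Lemma tens_eqb_sym : symmetric tens_eqb.
Proof. by move=> s t; apply/asboolP/asboolP => e W f hf; rewrite (e W f hf). Qed.

Lemma tens_eqb_trans : transitive tens_eqb.
Proof.
move=> t s r /asboolP e1 /asboolP e2; apply/asboolP => W f hf.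
by rewrite (e1 W f hf) (e2 W f hf).
Qed.

Canonical tens_equiv :=
  EquivRel tens_eqb tens_eqb_refl tens_eqb_sym tens_eqb_trans.

Definition tensor := {eq_quot tens_equiv}.
HB.instance Definition _ := Choice.on tensor.

Definition tclass (s : seq (U * V)) : tensor := \pi_{eq_quot tens_equiv} s.
Definition trepr (x : tensor) : seq (U * V) := repr x.

Definition tlift (W : lmodType K) (f : U -> V -> W) (x : tensor) : W :=
  tsum f (trepr x).

Lemma treprK x : tclass (trepr x) = x.
Proof. exact: reprK. Qed.

Lemma tclassP s t : tens_eq s t <-> tclass s = tclass t.
Proof.
split=> [e | /eqmodP /asboolP //].
by apply/eqmodP/asboolP.
Qed.

Lemma tlift_class (W : lmodType K) (f : U -> V -> W) s :
  bilin f -> tlift f (tclass s) = tsum f s.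
Proof. by move=> hf; have /tclassP/(_ W f hf) := treprK (tclass s). Qed.

Lemma tensorP (x y : tensor) :
  (forall (W : lmodType K) (f : U -> V -> W), bilin f -> tlift f x = tlift f y)
  -> x = y.
Proof.
by move=> e; rewrite -(treprK x) -(treprK y); apply/tclassP => W f /e.
Qed.

Definition tzero : tensor := tclass [::].
Definition tadd (x y : tensor) : tensor := tclass (trepr x ++ trepr y).
Definition tscale (a : K) (x : tensor) : tensor :=
  tclass [seq (a *: p.1, p.2) | p <- trepr x].
Definition topp (x : tensor) : tensor := tscale (-1) x.

Lemma tlift_zero (W : lmodType K) (f : U -> V -> W) :
  bilin f -> tlift f tzero = 0.
Proof. by move=> hf; rewrite tlift_class // /tsum big_nil. Qed.

Lemma tlift_add (W : lmodType K) (f : U -> V -> W) x y :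
  bilin f -> tlift f (tadd x y) = tlift f x + tlift f y.
Proof. by move=> hf; rewrite tlift_class // /tsum big_cat. Qed.

Lemma bilinZl (W : lmodType K) (f : U -> V -> W) a u v :
  bilin f -> f (a *: u) v = a *: f u v.
Proof. by move=> hf; exact: (scalable_linear (hf.1 v)). Qed.
Lemma bilinZr (W : lmodType K) (f : U -> V -> W) a u v :
  bilin f -> f u (a *: v) = a *: f u v.
Proof. by move=> hf; exact: (scalable_linear (hf.2 u)). Qed.
Lemma bilinDl (W : lmodType K) (f : U -> V -> W) u u' v :
  bilin f -> f (u + u') v = f u v + f u' v.
Proof. by move=> hf; have := hf.1 v 1 u u'; rewrite /= !scale1r. Qed.
Lemma bilinDr (W : lmodType K) (f : U -> V -> W) u v v' :
  bilin f -> f u (v + v') = f u v + f u v'.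
Proof. by move=> hf; have := hf.2 u 1 v v'; rewrite /= !scale1r. Qed.

Lemma tlift_scale (W : lmodType K) (f : U -> V -> W) a x :
  bilin f -> tlift f (tscale a x) = a *: tlift f x.
Proof.
move=> hf; rewrite tlift_class // /tlift /tsum big_map scaler_sumr.
by apply: eq_bigr => p _; rewrite bilinZl.
Qed.

Lemma taddA : associative tadd.
Proof. by move=> x y z; apply: tensorP => W f hf; rewrite !tlift_add // addrA. Qed.
Lemma taddC : commutative tadd.
Proof. by move=> x y; apply: tensorP => W f hf; rewrite !tlift_add // addrC. Qed.
Lemma tadd0 : left_id tzero tadd.
Proof.
by move=> x; apply: tensorP => W f hf; rewrite tlift_add // tlift_zero // add0r.
Qed.
Lemma taddN : left_inverse tzero topp tadd.
Proof.
move=> x; apply: tensorP => W f hf.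
by rewrite tlift_add // tlift_scale // tlift_zero // scaleN1r addNr.
Qed.
HB.instance Definition _ := GRing.isZmodule.Build tensor taddA taddC tadd0 taddN.

Lemma tscaleA a b x : tscale a (tscale b x) = tscale (a * b) x.
Proof. by apply: tensorP => W f hf; rewrite !tlift_scale // scalerA. Qed.
Lemma tscale1 : left_id 1 tscale.
Proof. by move=> x; apply: tensorP => W f hf; rewrite tlift_scale // scale1r. Qed.
Lemma tscaleDr : right_distributive tscale +%R.
Proof.
move=> a x y; apply: tensorP => W f hf.
by rewrite tlift_scale // !tlift_add // !tlift_scale // scalerDr.
Qed.
Lemma tscaleDl x : {morph tscale^~ x : a b / a + b}.
Proof.
move=> a b; apply: tensorP => W f hf.
by rewrite tlift_scale // tlift_add // !tlift_scale // scalerDl.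
Qed.
HB.instance Definition _ :=
  GRing.Zmodule_isLmodule.Build K tensor tscaleA tscale1 tscaleDr tscaleDl.

Definition tens (u : U) (v : V) : tensor := tclass [:: (u, v)].

Lemma tlift_tens (W : lmodType K) (f : U -> V -> W) u v :
  bilin f -> tlift f (tens u v) = f u v.
Proof. by move=> hf; rewrite tlift_class // /tsum big_seq1. Qed.

Lemma tlift_linear (W : lmodType K) (f : U -> V -> W) :
  bilin f -> linear (tlift f).
Proof. by move=> hf a x y; rewrite tlift_add // tlift_scale. Qed.

Lemma tens_bilin : bilin tens.
Proof.
split=> [v a u u' | u a v v']; apply: tensorP => W f hf;
  rewrite tlift_linear // !tlift_tens //.
  by rewrite bilinDl // bilinZl.
by rewrite bilinDr // bilinZr.
Qed.

Lemma tclass_sum s : tclass s = \sum_(p <- s) tens p.1 p.2.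
Proof.
elim: s => [|p s IHs]; first by rewrite big_nil.
rewrite big_cons -IHs; apply: tensorP => W f hf.
by rewrite tlift_add // tlift_tens // !tlift_class // /tsum big_cons.
Qed.

Lemma tens_span (x : tensor) : x = \sum_(p <- trepr x) tens p.1 p.2.
Proof. by rewrite -tclass_sum treprK. Qed.

Lemma tens_ind (P : tensor -> Prop) :
  P 0 -> (forall x y, P x -> P y -> P (x + y)) -> (forall u v, P (tens u v)) ->
  forall x, P x.
Proof. by move=> P0 PD Pt x; rewrite (tens_span x); elim/big_ind: _. Qed.

Lemma tensDl u u' v : tens (u + u') v = tens u v + tens u' v.
Proof. exact: bilinDl tens_bilin. Qed.
Lemma tensDr u v v' : tens u (v + v') = tens u v + tens u v'.
Proof. exact: bilinDr tens_bilin. Qed.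
Lemma tensZl a u v : tens (a *: u) v = a *: tens u v.
Proof. exact: bilinZl tens_bilin. Qed.
Lemma tensZr a u v : tens u (a *: v) = a *: tens u v.
Proof. exact: bilinZr tens_bilin. Qed.

End TensorDef.

Arguments tens {K U V} u v.
Notation "U \ox V" := (tensor U V) (at level 40, left associativity) : type_scope.
Notation "u \ot v" := (tens u v) (at level 40, left associativity) : ring_scope.

(* locked, so that simplification does not unfold the maps built with linpack *)
HB.lock Definition linpack (K : fieldType) (U V : lmodType K) (f : U -> V)
  (hf : linear f) : {linear U -> V} :=
  HB.pack f (GRing.isLinear.Build K U V _ f hf).
Arguments linpack {K U V f} hf.

Section LinearMaps.
Variable K : fieldType.
Implicit Types U V W : lmodType K.

Lemma linpackE U V (f : U -> V) (hf : linear f) u : linpack hf u = f u.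
Proof. by rewrite unlock. Qed.

Lemma linP U V (f g : {linear U -> V}) : f =1 g -> f = g.
Proof.
case: f g => [f cf] [g cg] /= e.
have {}e : f = g by apply/funext.
subst g; congr GRing.Linear.Pack.
case: cf cg => [[a1] [b1]] [[a2] [b2]].
by rewrite (Prop_irrelevance a1 a2) (Prop_irrelevance b1 b2).
Qed.

Definition linid U : {linear U -> U} := idfun.
Lemma lincomp_linear U V W (g : {linear V -> W}) (f : {linear U -> V}) :
  linear (g \o f).
Proof. exact: linearP. Qed.
Definition lincomp U V W (g : {linear V -> W}) (f : {linear U -> V}) :
  {linear U -> W} := linpack (lincomp_linear g f).
Lemma lincompE U V W (g : {linear V -> W}) (f : {linear U -> V}) u :
  lincomp g f u = g (f u).
Proof. exact: linpackE. Qed.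
Definition linzero U V : {linear U -> V} := \0.

Lemma tens0l U V (v : V) : (0 : U) \ot v = 0.
Proof. by rewrite -(scale0r 0) tensZl scale0r. Qed.
Lemma tens0r U V (u : U) : u \ot (0 : V) = 0.
Proof. by rewrite -(scale0r 0) tensZr scale0r. Qed.

Definition tens_lift U V W (f : U -> V -> W) (hf : bilin f) :
  {linear U \ox V -> W} := linpack (tlift_linear hf).

Lemma tens_liftE U V W (f : U -> V -> W) (hf : bilin f) u v :
  tens_lift hf (u \ot v) = f u v.
Proof. by rewrite /tens_lift linpackE; exact: tlift_tens. Qed.

Lemma tens_ext U V W (f g : {linear U \ox V -> W}) :
  (forall u v, f (u \ot v) = g (u \ot v)) -> f =1 g.
Proof.
move=> e; elim/tens_ind => [|x y Ex Ey|//]; first by rewrite !linear0.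
by rewrite !linearD Ex Ey.
Qed.

End LinearMaps.


Ltac tens_simp := rewrite ?(tens0l, tens0r, tensDl, tensDr, linear0, linearD) /=.
Ltac tens_step x :=
  let a := fresh "a" in let b := fresh "b" in
  let Ea := fresh "Ea" in let Eb := fresh "Eb" in
  elim/tens_ind: x => [|a b Ea Eb|];
    [by do 8?tens_simp | by do 8?tens_simp; rewrite Ea Eb | ].

Section TensorMaps.
Variable K : fieldType.
Implicit Types U V W : lmodType K.

Lemma tmap_bilin U U' V V' (f : {linear U -> U'}) (g : {linear V -> V'}) :
  bilin (fun u v => f u \ot g v).
Proof.
split=> [v a u u' | u a v v'] /=; first by rewrite linearP tensDl tensZl.
by rewrite linearP tensDr tensZr.
Qed.

Definition tmap U U' V V' (f : {linear U -> U'}) (g : {linear V -> V'}) :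
  {linear U \ox V -> U' \ox V'} := tens_lift (tmap_bilin f g).

Lemma tmapE U U' V V' (f : {linear U -> U'}) (g : {linear V -> V'}) u v :
  tmap f g (u \ot v) = f u \ot g v.
Proof. exact: tens_liftE. Qed.

Lemma tswap_bilin U V : bilin (fun (u : U) (v : V) => v \ot u).
Proof.
by split=> [v a u u' | u a v v'] /=; rewrite (tensDl, tensDr) (tensZl, tensZr).
Qed.
Definition tswap U V : {linear U \ox V -> V \ox U} :=
  tens_lift (@tswap_bilin U V).
Lemma tswapE U V (u : U) (v : V) : tswap U V (u \ot v) = v \ot u.
Proof. exact: tens_liftE. Qed.

Lemma tassoc_bilin1 U V W (w : W) :
  bilin (fun (u : U) (v : V) => u \ot (v \ot w)).
Proof.
split=> [v a u u' | u a v v'] /=; first by rewrite tensDl tensZl.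
by rewrite tensDl tensZl tensDr tensZr.
Qed.
Lemma tassoc_bilin2 U V W :
  bilin (fun (x : U \ox V) (w : W) => tens_lift (@tassoc_bilin1 U V W w) x).
Proof.
split=> [w a x x' | x a w w']; first by rewrite linearP.
rewrite /= in x *; elim/tens_ind: x => [|x y Ex Ey|u v].
- by rewrite !linear0 addr0.
- by rewrite !linearD Ex Ey addrACA.
by rewrite !tens_liftE !(tensDr, tensZr).
Qed.
Definition tassoc U V W : {linear (U \ox V) \ox W -> U \ox (V \ox W)} :=
  tens_lift (@tassoc_bilin2 U V W).

Lemma tassocE U V W (u : U) (v : V) (w : W) :
  tassoc U V W ((u \ot v) \ot w) = u \ot (v \ot w).
Proof. by rewrite !tens_liftE. Qed.

Lemma tassocV_bilin1 U V W (u : U) :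
  bilin (fun (v : V) (w : W) => (u \ot v) \ot w).
Proof.
split=> [w a v v' | v a w w'] /=; last by rewrite tensDr tensZr.
by rewrite tensDr tensZr tensDl tensZl.
Qed.
Lemma tassocV_bilin2 U V W :
  bilin (fun (u : U) (x : V \ox W) => tens_lift (@tassocV_bilin1 U V W u) x).
Proof.
split=> [x a u u' | u a x x']; last by rewrite linearP.
rewrite /= in x *; elim/tens_ind: x => [|x y Ex Ey|v w].
- by rewrite !linear0 addr0.
- by rewrite !linearD Ex Ey addrACA.
by rewrite !tens_liftE !(tensDl, tensZl).
Qed.
Definition tassocV U V W : {linear U \ox (V \ox W) -> (U \ox V) \ox W} :=
  tens_lift (@tassocV_bilin2 U V W).
Lemma tassocVE U V W (u : U) (v : V) (w : W) :
  tassocV U V W (u \ot (v \ot w)) = (u \ot v) \ot w.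
Proof. by rewrite !tens_liftE. Qed.

Lemma tunitl_bilin V : bilin (fun (a : K^o) (v : V) => (a : K) *: v).
Proof.
split=> [v a b c | b a v v'] /=; first by rewrite scalerDl scalerA.
by rewrite scalerDr !scalerA mulrC.
Qed.
Definition tunitl V : {linear K^o \ox V -> V} := tens_lift (@tunitl_bilin V).
Lemma tunitlE V (a : K^o) (v : V) : tunitl V (a \ot v) = (a : K) *: v.
Proof. exact: tens_liftE. Qed.

Lemma tunitlV_linear V : linear (fun v : V => (1 : K^o) \ot v).
Proof. by move=> a v w; rewrite tensDr tensZr. Qed.
Definition tunitlV V : {linear V -> K^o \ox V} := linpack (@tunitlV_linear V).

Lemma tunitlVE V (v : V) : tunitlV V v = (1 : K^o) \ot v.
Proof. exact: linpackE. Qed.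

Lemma tunitr_bilin V : bilin (fun (v : V) (a : K^o) => (a : K) *: v).
Proof.
split=> [a b v v' | v b a c] /=; last by rewrite scalerDl scalerA.
by rewrite scalerDr !scalerA mulrC.
Qed.
Definition tunitr V : {linear V \ox K^o -> V} := tens_lift (@tunitr_bilin V).
Lemma tunitrE V (v : V) (a : K^o) : tunitr V (v \ot a) = (a : K) *: v.
Proof. exact: tens_liftE. Qed.

Lemma tunitrV_linear V : linear (fun v : V => v \ot (1 : K^o)).
Proof. by move=> a v w; rewrite tensDl tensZl. Qed.
Definition tunitrV V : {linear V -> V \ox K^o} := linpack (@tunitrV_linear V).
Lemma tunitrVE V (v : V) : tunitrV V v = v \ot (1 : K^o).
Proof. exact: linpackE. Qed.

Lemma tmul_bilin (A : algType K) : bilin (fun x y : A => x * y).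
Proof.
split=> [y a x x' | x a y y'] /=; first by rewrite mulrDl scalerAl.
by rewrite mulrDr scalerAr.
Qed.
Definition tmul (A : algType K) : {linear A \ox A -> A} :=
  tens_lift (@tmul_bilin A).
Lemma tmulE (A : algType K) (x y : A) : tmul A (x \ot y) = x * y.
Proof. exact: tens_liftE. Qed.

Lemma tone_linear (A : algType K) : linear (fun a : K^o => (a : K) *: (1 : A)).
Proof. by move=> a b c; rewrite scalerDl scalerA. Qed.
Definition tone (A : algType K) : {linear K^o -> A} := linpack (@tone_linear A).
Lemma toneE (A : algType K) (a : K^o) : tone A a = (a : K)%:A.
Proof. exact: linpackE. Qed.

End TensorMaps.

(* (u (x) v) (x) (u' (x) v') |-> (u (x) u') (x) (v (x) v') *)
HB.lock Definition tmid (K : fieldType) (U V U' V' : lmodType K) :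
  {linear (U \ox V) \ox (U' \ox V') -> (U \ox U') \ox (V \ox V')} :=
  lincomp (tassocV U U' (V \ox V'))
  (lincomp (tmap (linid U)
     (lincomp (tassoc U' V V')
     (lincomp (tmap (tswap V U') (linid V')) (tassocV V U' V'))))
   (tassoc U V (U' \ox V'))).
Arguments tmid {K}.

Lemma tmidE (K : fieldType) (U V U' V' : lmodType K)
    (u : U) (v : V) (u' : U') (v' : V') :
  tmid U V U' V' ((u \ot v) \ot (u' \ot v')) = (u \ot u') \ot (v \ot v').
Proof. by rewrite unlock !(tassocE, tmapE, tassocVE, tswapE, lincompE). Qed.


(* Monoidal categories with zero morphisms: the part of the structure of an
   abelian monoidal category that kernels and formal smoothness refer to. *)
Record moncat := MonCat {
  mobj :> Type;
  mhom : mobj -> mobj -> Type;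
  idm : forall X, mhom X X;
  mcomp : forall X Y Z, mhom Y Z -> mhom X Y -> mhom X Z;
  zerom : forall X Y, mhom X Y;
  compA : forall X Y Z T (h : mhom Z T) (g : mhom Y Z) (f : mhom X Y),
    mcomp h (mcomp g f) = mcomp (mcomp h g) f;
  comp1m : forall X Y (f : mhom X Y), mcomp (idm Y) f = f;
  compm1 : forall X Y (f : mhom X Y), mcomp f (idm X) = f;
  comp0m : forall X Y Z (f : mhom X Y), mcomp (zerom Y Z) f = zerom X Z;
  compm0 : forall X Y Z (f : mhom Y Z), mcomp f (zerom X Y) = zerom X Z;
  mtens : mobj -> mobj -> mobj;
  mtensm : forall X X' Y Y',
    mhom X X' -> mhom Y Y' -> mhom (mtens X Y) (mtens X' Y');
  munit : mobj;
  massoc : forall X Y Z, mhom (mtens (mtens X Y) Z) (mtens X (mtens Y Z));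
  massocV : forall X Y Z, mhom (mtens X (mtens Y Z)) (mtens (mtens X Y) Z);
  mlunit : forall X, mhom (mtens munit X) X;
  mlunitV : forall X, mhom X (mtens munit X);
  mrunit : forall X, mhom (mtens X munit) X;
  mrunitV : forall X, mhom X (mtens X munit);
  mtensm1 : forall X Y, mtensm (idm X) (idm Y) = idm (mtens X Y);
  mtensm_comp : forall X Y Z X' Y' Z'
    (g : mhom Y Z) (f : mhom X Y) (g' : mhom Y' Z') (f' : mhom X' Y'),
    mtensm (mcomp g f) (mcomp g' f') = mcomp (mtensm g g') (mtensm f f');
  massoc_nat : forall X Y Z X' Y' Z'
    (f : mhom X X') (g : mhom Y Y') (h : mhom Z Z'),
    mcomp (massoc X' Y' Z') (mtensm (mtensm f g) h)
    = mcomp (mtensm f (mtensm g h)) (massoc X Y Z);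
  mlunit_nat : forall X Y (f : mhom X Y),
    mcomp (mlunit Y) (mtensm (idm munit) f) = mcomp f (mlunit X);
  mrunit_nat : forall X Y (f : mhom X Y),
    mcomp (mrunit Y) (mtensm f (idm munit)) = mcomp f (mrunit X);
  massocK : forall X Y Z, mcomp (massocV X Y Z) (massoc X Y Z) = idm _;
  massocVK : forall X Y Z, mcomp (massoc X Y Z) (massocV X Y Z) = idm _;
  mlunitK : forall X, mcomp (mlunitV X) (mlunit X) = idm _;
  mlunitVK : forall X, mcomp (mlunit X) (mlunitV X) = idm _;
  mrunitK : forall X, mcomp (mrunitV X) (mrunit X) = idm _;
  mrunitVK : forall X, mcomp (mrunit X) (mrunitV X) = idm _;
  mpentagon : forall X Y Z T,
    mcomp (massoc X Y (mtens Z T)) (massoc (mtens X Y) Z T)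
    = mcomp (mtensm (idm X) (massoc Y Z T))
        (mcomp (massoc X (mtens Y Z) T) (mtensm (massoc X Y Z) (idm T)));
  mtriangle : forall X Y,
    mcomp (mtensm (idm X) (mlunit Y)) (massoc X munit Y)
    = mtensm (mrunit X) (idm Y)
}.

Arguments mhom {m}.
Arguments idm {m}.
Arguments mcomp {m X Y Z}.
Arguments zerom {m}.
Arguments mtens {m}.
Arguments mtensm {m X X' Y Y'}.
Arguments munit {m}.
Arguments massoc {m}.
Arguments massocV {m}.
Arguments mlunit {m}.
Arguments mlunitV {m}.
Arguments mrunit {m}.
Arguments mrunitV {m}.

Declare Scope moncat_scope.
Delimit Scope moncat_scope with M.
Notation "g \cm f" := (mcomp g f) (at level 50, left associativity) : moncat_scope.
Notation "X \xx Y" := (mtens X Y) (at level 40, left associativity) : moncat_scope.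
Notation "f \xm g" := (mtensm f g) (at level 40, left associativity) : moncat_scope.

Section FormalSmoothness.
Local Open Scope moncat_scope.
Variable M : moncat.

Record malgebra := MAlgebra {
  acar :> M;
  amul : mhom (acar \xx acar) acar;
  aunit : mhom munit acar;
  amulA : amul \cm (amul \xm idm acar)
          = amul \cm (idm acar \xm amul) \cm massoc acar acar acar;
  amul1l : amul \cm (aunit \xm idm acar) = mlunit acar;
  amul1r : amul \cm (idm acar \xm aunit) = mrunit acar
}.

Variable A : malgebra.

Record mbimodule := MBimodule {
  bcar :> M;
  lact : mhom (A \xx bcar) bcar;
  ract : mhom (bcar \xx A) bcar;
  lactA : lact \cm (amul A \xm idm bcar)
          = lact \cm (idm A \xm lact) \cm massoc A A bcar;
  lact1 : lact \cm (aunit A \xm idm bcar) = mlunit bcar;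
  ractA : ract \cm (ract \xm idm A)
          = ract \cm (idm bcar \xm amul A) \cm massoc bcar A A;
  ract1 : ract \cm (idm bcar \xm aunit A) = mrunit bcar;
  lractA : ract \cm (lact \xm idm A)
           = lact \cm (idm A \xm ract) \cm massoc A bcar A
}.

Definition bimod_hom (X Y : mbimodule) (f : mhom X Y) : Prop :=
  f \cm lact X = lact Y \cm (idm A \xm f) /\
  f \cm ract X = ract Y \cm (f \xm idm A).

Definition is_kernel (N X Y : M) (i : mhom N X) (f : mhom X Y) : Prop :=
  f \cm i = zerom N Y /\
  forall (Z : M) (g : mhom Z X), f \cm g = zerom Z Y ->
    exists! h : mhom Z N, i \cm h = g.

(* N is Omega^1 A: a kernel i : N -> A (x) A of the multiplication, with the
   bimodule structure making i a bimodule morphism, where A acts on A (x) A by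
   multiplication on the outer factors. *)
Definition is_Omega1 (N : mbimodule) (i : mhom N (A \xx A)) : Prop :=
  [/\ is_kernel i (amul A),
      i \cm lact N = (amul A \xm idm A) \cm massocV A A A \cm (idm A \xm i)
    & i \cm ract N = (idm A \xm amul A) \cm massoc A A A \cm (i \xm idm A)].

Definition has_section (X Y : M) (f : mhom X Y) : Prop :=
  exists s : mhom Y X, f \cm s = idm Y.

(* projectivity relative to the class of the bimodule morphisms that split
   in M *)
Definition E_projective (P : mbimodule) : Prop :=
  forall (X Y : mbimodule) (f : mhom X Y), bimod_hom f -> has_section f ->
  forall g : mhom P Y, bimod_hom g ->
  exists2 h : mhom P X, bimod_hom h & f \cm h = g.

(* kernels being unique up to isomorphism, the choice of N is immaterial *)
Definition formally_smooth : Prop :=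
  exists (N : mbimodule) (i : mhom N (A \xx A)), is_Omega1 i /\ E_projective N.

End FormalSmoothness.

Section VectCat.
Variable K : fieldType.

Definition vect_moncat : moncat.
Proof.
refine (@MonCat (lmodType K) (fun U V => {linear U -> V}) (@linid K)
  (@lincomp K) (@linzero K) _ _ _ _ _ (fun U V => (U \ox V : lmodType K))
  (@tmap K) (K^o : lmodType K) (@tassoc K) (@tassocV K) (@tunitl K)
  (@tunitlV K) (@tunitr K) (@tunitrV K) _ _ _ _ _ _ _ _ _ _ _ _ _).
- by move=> *; apply: linP => x; rewrite !lincompE.
- by move=> *; apply: linP => x; rewrite !lincompE.
- by move=> *; apply: linP => x; rewrite !lincompE.
- by move=> *; apply: linP => x; rewrite !lincompE.
- by move=> X Y Z f; apply: linP => x; rewrite !lincompE linear0.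
- by move=> X Y; apply/linP/tens_ext => u v; rewrite tmapE.
- by move=> *; apply/linP/tens_ext => u v; rewrite !(tmapE, lincompE).
- move=> *; apply/linP/tens_ext => x w; rewrite !lincompE; tens_step x => u v.
  by rewrite !(tmapE, tassocE, lincompE).
- move=> *; apply/linP/tens_ext => u v.
  by rewrite !(tmapE, tunitlE, lincompE) linearZZ.
- move=> *; apply/linP/tens_ext => u v.
  by rewrite !(tmapE, tunitrE, lincompE) linearZZ.
- move=> *; apply/linP/tens_ext => x w; rewrite !lincompE; tens_step x => u v.
  by rewrite !(tassocE, tassocVE, lincompE).
- move=> *; apply/linP/tens_ext => u x; rewrite !lincompE; tens_step x => v w.
  by rewrite !(tassocE, tassocVE, lincompE).
- move=> *; apply/linP/tens_ext => a v; rewrite lincompE.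
  by rewrite tunitlE tunitlVE tensZr -tensZl; congr (_ \ot _); exact: mulr1.
- by move=> *; apply/linP => v; rewrite lincompE tunitlVE tunitlE scale1r.
- move=> *; apply/linP/tens_ext => v a; rewrite lincompE.
  by rewrite tunitrE tunitrVE tensZl -tensZr; congr (_ \ot _); exact: mulr1.
- by move=> *; apply/linP => v; rewrite lincompE tunitrVE tunitrE scale1r.
- move=> *; apply/linP/tens_ext => x t; rewrite !lincompE; tens_step x => y w; tens_step y => u v.
  by rewrite !(tassocE, tmapE, lincompE).
- move=> *; apply/linP/tens_ext => x w; rewrite !lincompE; tens_step x => u a.
  by rewrite !(tassocE, tmapE, tunitlE, tunitrE, lincompE) tensZl tensZr.
Defined.
End VectCat.

Record hopfAlgebra (K : fieldType) := HopfAlgebra {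
  hcar :> algType K;
  hcomul : {linear hcar -> hcar \ox hcar};
  hcounit : {linear hcar -> K^o};
  hantipode : {linear hcar -> hcar};
  hcomulA : forall x,
    tassoc _ _ _ (tmap hcomul (linid hcar) (hcomul x))
    = tmap (linid hcar) hcomul (hcomul x);
  hcounitl : forall x, tunitl _ (tmap hcounit (linid hcar) (hcomul x)) = x;
  hcounitr : forall x, tunitr _ (tmap (linid hcar) hcounit (hcomul x)) = x;
  hcomulM : forall x y,
    hcomul (x * y)
    = tmap (tmul hcar) (tmul hcar) (tmid _ _ _ _ (hcomul x \ot hcomul y));
  hcomul1 : hcomul 1 = 1 \ot 1;
  hcounitM : forall x y, hcounit (x * y) = hcounit x * hcounit y;
  hcounit1 : hcounit 1 = 1;
  hantipodel : forall x,
    tmul hcar (tmap hantipode (linid hcar) (hcomul x)) = (hcounit x : K)%:A;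
  hantipoder : forall x,
    tmul hcar (tmap (linid hcar) hantipode (hcomul x)) = (hcounit x : K)%:A
}.

Section VectAlgebra.
Variables (K : fieldType) (A : algType K).

Definition vect_algebra : malgebra (vect_moncat K).
Proof.
refine (@MAlgebra (vect_moncat K) (A : lmodType K) (tmul A) (tone A) _ _ _).
- apply/linP/tens_ext => x z; rewrite !lincompE; tens_step x => x y.
  by rewrite !(tassocE, tmapE, tmulE, lincompE) mulrA.
- apply/linP/tens_ext => a x.
  by rewrite !(tmapE, tmulE, tunitlE, toneE, lincompE) mulr_algl.
- apply/linP/tens_ext => x a.
  by rewrite !(tmapE, tmulE, tunitrE, toneE, lincompE) mulr_algr.
Defined.
End VectAlgebra.

Section Comodules.
Variables (K : fieldType) (H : hopfAlgebra K).

Record comodule := Comodule {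
  ccar :> lmodType K;
  coact : {linear ccar -> ccar \ox H};
  coactA : forall v,
    tassoc _ _ _ (tmap coact (linid H) (coact v))
    = tmap (linid ccar) (hcomul H) (coact v);
  coact1 : forall v, tunitr _ (tmap (linid ccar) (hcounit H) (coact v)) = v
}.

Record comod_hom (V W : comodule) := ComodHom {
  chlin :> {linear V -> W};
  chcolin : forall v, coact W (chlin v) = tmap chlin (linid H) (coact V v)
}.

Lemma comod_homP V W (f g : comod_hom V W) : (chlin f = chlin g) -> f = g.
Proof.
case: f g => [f hf] [g hg] /= e; subst g.
by rewrite (Prop_irrelevance hf hg).
Qed.

Lemma tmap_id (U V : lmodType K) x : tmap (linid U) (linid V) x = x.
Proof. by move: x; apply: (tens_ext (g := linid _)) => u v; rewrite tmapE. Qed.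

Lemma tmap_comp (U V W U' V' W' : lmodType K) (g : {linear V -> W})
  (f : {linear U -> V}) (g' : {linear V' -> W'}) (f' : {linear U' -> V'}) x :
  tmap g g' (tmap f f' x) = tmap (lincomp g f) (lincomp g' f') x.
Proof.
elim/tens_ind: x => [|x y Ex Ey|u v]; first by rewrite !linear0.
  by rewrite !linearD Ex Ey.
by rewrite !(tmapE, lincompE).
Qed.

Definition comod_id V : comod_hom V V.
Proof. by exists (linid V) => v; rewrite tmap_id. Defined.

Definition comod_comp U V W (g : comod_hom V W) (f : comod_hom U V) :
  comod_hom U W.
Proof.
exists (lincomp g f) => v.
rewrite lincompE !chcolin tmap_comp; congr (tmap _ _ _).
by apply: linP => x; rewrite lincompE.
Defined.

Definition comod_zero V W : comod_hom V W.
Proof.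
exists (linzero V W) => v; rewrite /= linear0.
elim/tens_ind: (coact V v) => [|x y Ex Ey|u h]; first by rewrite linear0.
  by rewrite linearD -Ex -Ey addr0.
by rewrite tmapE tens0l.
Defined.

(* codiagonal coaction v (x) w |-> v0 (x) w0 (x) v1 w1 *)
Definition codiag_map (V W : lmodType K) :
  {linear (V \ox H) \ox (W \ox H) -> (V \ox W) \ox H} :=
  lincomp (tmap (linid _) (tmul H)) (tmid V H W H).

Definition codiag (V W : comodule) : {linear V \ox W -> (V \ox W) \ox H} :=
  lincomp (codiag_map V W) (tmap (coact V) (coact W)).

Lemma codiag_mapE (V W : lmodType K) (v : V) (w : W) (h k : H) :
  codiag_map V W ((v \ot h) \ot (w \ot k)) = (v \ot w) \ot (h * k).
Proof. by rewrite lincompE tmidE tmapE tmulE. Qed.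

Lemma codiagE (V W : comodule) (v : V) (w : W) :
  codiag V W (v \ot w) = codiag_map V W (coact V v \ot coact W w).
Proof. by rewrite lincompE tmapE. Qed.

Lemma codiagA (V W : comodule) x :
  tassoc _ _ _ (tmap (codiag V W) (linid H) (codiag V W x))
  = tmap (linid (V \ox W)) (hcomul H) (codiag V W x).
Proof.
tens_step x => v w; rewrite codiagE.
pose m2 : {linear (H \ox H) \ox (H \ox H) -> H \ox H} :=
  lincomp (tmap (tmul H) (tmul H)) (tmid H H H H).
have E1 (a : V \ox H) (b : W \ox H) :
    tmap (linid (V \ox W)) (hcomul H) (codiag_map V W (a \ot b))
    = tmap (linid (V \ox W)) m2
        (tmid _ _ _ _ (tmap (linid V) (hcomul H) a \ot
                       tmap (linid W) (hcomul H) b)).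
  tens_step a => v' h; tens_step b => w' k.
  by rewrite codiag_mapE !(tmapE, tmidE) hcomulM lincompE.
have E2 (a : V \ox H) (b : W \ox H) :
    tassoc _ _ _ (tmap (codiag V W) (linid H) (codiag_map V W (a \ot b)))
    = tmap (linid (V \ox W)) m2
        (tmid _ _ _ _ (tassoc _ _ _ (tmap (coact V) (linid H) a) \ot
                       tassoc _ _ _ (tmap (coact W) (linid H) b))).
  tens_step a => v' h; tens_step b => w' k.
  rewrite codiag_mapE !tmapE codiagE /=.
  move: (coact V v') (coact W w') => c d.
  tens_step c => v2 h2; tens_step d => w2 k2.
  by rewrite codiag_mapE !(tassocE, tmidE, tmapE, tmulE, lincompE).
by rewrite E1 E2 !coactA.
Qed.

Lemma codiag1 (V W : comodule) x :
  tunitr _ (tmap (linid (V \ox W)) (hcounit H) (codiag V W x)) = x.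
Proof.
tens_step x => v w; rewrite codiagE.
have E (a : V \ox H) (b : W \ox H) :
    tunitr _ (tmap (linid (V \ox W)) (hcounit H) (codiag_map V W (a \ot b)))
    = tunitr _ (tmap (linid V) (hcounit H) a)
      \ot tunitr _ (tmap (linid W) (hcounit H) b).
  tens_step a => v' h; tens_step b => w' k.
  rewrite codiag_mapE !tmapE !tunitrE hcounitM /=.
  by rewrite tensZl tensZr scalerA.
by rewrite E !coact1.
Qed.

Definition comod_tens (V W : comodule) : comodule :=
  Comodule (@codiagA V W) (@codiag1 V W).

Lemma unit_coact_linear : linear (fun a : K^o => a \ot (1 : H)).
Proof. by move=> a b c; rewrite tensDl tensZl. Qed.

Definition unit_coact : {linear K^o -> K^o \ox H} := linpack unit_coact_linear.
Lemma unit_coactE a : unit_coact a = a \ot (1 : H).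
Proof. exact: linpackE. Qed.

Lemma unit_coactA a :
  tassoc _ _ _ (tmap unit_coact (linid H) (unit_coact a))
  = tmap (linid K^o) (hcomul H) (unit_coact a).
Proof. by rewrite !unit_coactE !tmapE unit_coactE tassocE hcomul1. Qed.

Lemma unit_coact1 a :
  tunitr _ (tmap (linid K^o) (hcounit H) (unit_coact a)) = a.
Proof. by rewrite unit_coactE tmapE tunitrE hcounit1 scale1r. Qed.

Definition comod_unit : comodule := Comodule unit_coactA unit_coact1.

Lemma tmapD_colin (V V' W W' : comodule) (f : comod_hom V V')
    (g : comod_hom W W') x :
  coact (comod_tens V' W') (tmap f g x)
  = tmap (tmap f g) (linid H) (coact (comod_tens V W) x).
Proof.
rewrite /=; tens_step x => v w; rewrite tmapE !codiagE !chcolin.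
move: (coact V v) (coact W w) => a b.
tens_step a => v' h; tens_step b => w' k.
by rewrite !(tmapE, codiag_mapE).
Qed.

Definition comod_tensm V V' W W' (f : comod_hom V V') (g : comod_hom W W') :
  comod_hom (comod_tens V W) (comod_tens V' W') :=
  @ComodHom (comod_tens V W) (comod_tens V' W') (tmap f g) (tmapD_colin f g).

Lemma tassoc_colin (U V W : comodule) x :
  coact (comod_tens U (comod_tens V W)) (tassoc U V W x)
  = tmap (tassoc U V W) (linid H) (coact (comod_tens (comod_tens U V) W) x).
Proof.
rewrite /=; tens_step x => y w; tens_step y => u v.
rewrite tassocE !codiagE /= ?codiagE.
move: (coact U u) (coact V v) (coact W w) => a b c.
tens_step a => u' h; tens_step b => v' k; tens_step c => w' l.
by rewrite !(tassocE, tmapE, codiag_mapE) mulrA.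
Qed.
Definition comod_assoc U V W :=
  @ComodHom (comod_tens (comod_tens U V) W) (comod_tens U (comod_tens V W))
    (tassoc U V W) (@tassoc_colin U V W).

Lemma tassocV_colin (U V W : comodule) x :
  coact (comod_tens (comod_tens U V) W) (tassocV U V W x)
  = tmap (tassocV U V W) (linid H) (coact (comod_tens U (comod_tens V W)) x).
Proof.
rewrite /=; tens_step x => u y; tens_step y => v w.
rewrite tassocVE !codiagE /= ?codiagE.
move: (coact U u) (coact V v) (coact W w) => a b c.
tens_step a => u' h; tens_step b => v' k; tens_step c => w' l.
by rewrite !(tassocVE, tmapE, codiag_mapE) mulrA.
Qed.
Definition comod_assocV U V W :=
  @ComodHom (comod_tens U (comod_tens V W)) (comod_tens (comod_tens U V) W)
    (tassocV U V W) (@tassocV_colin U V W).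

Lemma tunitl_colin (V : comodule) x :
  coact V (tunitl V x) = tmap (tunitl V) (linid H) (coact (comod_tens comod_unit V) x).
Proof.
rewrite /=; tens_step x => a v; rewrite codiagE tunitlE /= unit_coactE linearZZ.
move: (coact V v) => b; tens_step b => v' h.
by rewrite codiag_mapE tmapE tunitlE mul1r tensZl.
Qed.
Definition comod_lunit V := 
  @ComodHom (comod_tens comod_unit V) V (tunitl V) (@tunitl_colin V).

Lemma tunitlV_colin (V : comodule) x :
  coact (comod_tens comod_unit V) (tunitlV V x)
  = tmap (tunitlV V) (linid H) (coact V x).
Proof.
rewrite /= tunitlVE codiagE /= unit_coactE.
move: (coact V x) => b; tens_step b => v' h.
by rewrite codiag_mapE tmapE tunitlVE mul1r.
Qed.
Definition comod_lunitV V := 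
  @ComodHom V (comod_tens comod_unit V) (tunitlV V) (@tunitlV_colin V).

Lemma tunitr_colin (V : comodule) x :
  coact V (tunitr V x) = tmap (tunitr V) (linid H) (coact (comod_tens V comod_unit) x).
Proof.
rewrite /=; tens_step x => v a; rewrite codiagE tunitrE /= unit_coactE linearZZ.
move: (coact V v) => b; tens_step b => v' h.
by rewrite codiag_mapE tmapE tunitrE mulr1 tensZl.
Qed.
Definition comod_runit V := 
  @ComodHom (comod_tens V comod_unit) V (tunitr V) (@tunitr_colin V).

Lemma tunitrV_colin (V : comodule) x :
  coact (comod_tens V comod_unit) (tunitrV V x)
  = tmap (tunitrV V) (linid H) (coact V x).
Proof.
rewrite /= tunitrVE codiagE /= unit_coactE.
move: (coact V x) => b; tens_step b => v' h.
by rewrite codiag_mapE tmapE tunitrVE mulr1.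
Qed.
Definition comod_runitV V := 
  @ComodHom V (comod_tens V comod_unit) (tunitrV V) (@tunitrV_colin V).

Definition comod_moncat : moncat.
Proof.
pose M := vect_moncat K.
refine (@MonCat comodule comod_hom comod_id comod_comp comod_zero
  _ _ _ _ _ comod_tens comod_tensm comod_unit comod_assoc comod_assocV
  comod_lunit comod_lunitV comod_runit comod_runitV
  _ _ _ _ _ _ _ _ _ _ _ _ _) => *; apply: comod_homP.
- exact: (@compA M).
- exact: (@comp1m M).
- exact: (@compm1 M).
- exact: (@comp0m M).
- exact: (@compm0 M).
- exact: (@mtensm1 M).
- exact: (@mtensm_comp M).
- exact: (@massoc_nat M).
- exact: (@mlunit_nat M).
- exact: (@mrunit_nat M).
- exact: (@massocK M).
- exact: (@massocVK M).
- exact: (@mlunitK M).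
- exact: (@mlunitVK M).
- exact: (@mrunitK M).
- exact: (@mrunitVK M).
- exact: (@mpentagon M).
- exact: (@mtriangle M).
Defined.

Definition regular_comodule : comodule := Comodule (@hcomulA K H) (@hcounitr K H).

Lemma tmul_colin x :
  coact regular_comodule (tmul H x)
  = tmap (tmul H) (linid H)
      (coact (comod_tens regular_comodule regular_comodule) x).
Proof.
rewrite /=; tens_step x => x y; rewrite tmulE codiagE /= hcomulM lincompE.
by rewrite tmap_comp; congr (tmap _ _ _); apply: linP => z; rewrite lincompE.
Qed.
Definition comod_mul :
  comod_hom (comod_tens regular_comodule regular_comodule) regular_comodule :=
  @ComodHom (comod_tens regular_comodule regular_comodule) regular_comodule
    (tmul H) tmul_colin.

Lemma tone_colin a :
  coact regular_comodule (tone H a) = tmap (tone H) (linid H) (coact comod_unit a).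
Proof.
by rewrite /= unit_coactE tmapE toneE linearZZ hcomul1 tensZl.
Qed.
Definition comod_one : comod_hom comod_unit regular_comodule :=
  @ComodHom comod_unit regular_comodule (tone H) tone_colin.

Definition comod_algebra : malgebra comod_moncat.
Proof.
pose A := vect_algebra H.
refine (@MAlgebra comod_moncat regular_comodule comod_mul comod_one _ _ _);
  apply: comod_homP.
- exact: (amulA A).
- exact: (amul1l A).
- exact: (amul1r A).
Defined.

End Comodules.

Section Modules.
Variable R : pzRingType.

Section Submodule.
Variables (V : lmodType R) (S : submodClosed V).

Record submodule := Submodule { submod_val : V; submod_valP : submod_val \in S }.
HB.instance Definition _ := [isSub for submod_val].
HB.instance Definition _ := [Choice of submodule by <:].
HB.instance Definition _ := [SubChoice_isSubLmodule of submodule by <:].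
End Submodule.

Definition projective_module (P : lmodType R) : Prop :=
  forall (X Y : lmodType R) (f : {linear X -> Y}),
  (forall y, exists x, f x = y) ->
  forall g : {linear P -> Y}, exists h : {linear P -> X}, forall p, f (h p) = g p.

Definition hereditary : Prop :=
  forall (P : lmodType R) (S : submodClosed P),
  projective_module P -> projective_module (submodule S).
End Modules.

Definition finite_dimensional (K : fieldType) (V : lmodType K) : Prop :=
  exists (n : nat) (f : {linear V -> 'rV[K]_n}), bijective f.

Section Augmentation.
Variables (K : fieldType) (H : hopfAlgebra K).

Definition augmentation_pred : {pred H} := [pred x | hcounit H x == 0].

(* the kernel of the counit as a K-subspace of H and as a left ideal, i.e. a
   submodule of the left regular module H^o *)
Lemma augmentation_closedK : GRing.submod_closed (augmentation_pred : {pred H}).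
Proof.
split; first by rewrite inE linear0.
by move=> a x y; rewrite !inE linearP => /eqP-> /eqP->; rewrite scaler0 addr0.
Qed.

Lemma augmentation_closedH :
  GRing.submod_closed (augmentation_pred : {pred H^o}).
Proof.
split; first by rewrite inE linear0.
move=> a x y; rewrite !inE linearD /GRing.scale /= hcounitM.
by move=> /eqP-> /eqP->; rewrite mulr0 addr0.
Qed.

Definition augmentation_subspace : submodClosed H :=
  HB.pack augmentation_pred
    (GRing.isSubmodClosed.Build K H augmentation_pred augmentation_closedK).

Definition augmentation_ideal : submodClosed (H^o : lmodType H) :=
  HB.pack (augmentation_pred : {pred H^o})
    (GRing.isSubmodClosed.Build H H^o augmentation_pred augmentation_closedH).

Definition Hplus : lmodType K := submodule augmentation_subspace.
Definition Hplus_module : lmodType H := submodule augmentation_ideal.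

Definition Hplus_incl : {linear Hplus -> H} := \val.

Definition lmul (h : H) : {linear H -> H} := linpack ((tmul_bilin H).2 h).

Lemma Hplus_lmul_subproof (h : H) (x : Hplus) :
  h * Hplus_incl x \in augmentation_subspace.
Proof.
by rewrite inE hcounitM; have := submod_valP x; rewrite inE => /eqP->; rewrite mulr0.
Qed.

Definition Hplus_lmul_fun (h : H) (x : Hplus) : Hplus :=
  Submodule (Hplus_lmul_subproof h x).

Lemma Hplus_incl_inj : injective Hplus_incl.
Proof. exact: val_inj. Qed.

Lemma Hplus_lmul_bilin : bilin Hplus_lmul_fun.
Proof.
split=> [x a h k | h a x y]; apply: Hplus_incl_inj; rewrite linearP.
  by change ((a *: h + k) * Hplus_incl x
             = a *: (h * Hplus_incl x) + k * Hplus_incl x);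
     rewrite mulrDl scalerAl.
change (h * Hplus_incl (a *: x + y)
        = a *: (h * Hplus_incl x) + h * Hplus_incl y).
by rewrite linearP mulrDr scalerAr.
Qed.

Definition Hplus_lmul (h : H) : {linear Hplus -> Hplus} :=
  linpack (Hplus_lmul_bilin.2 h).

Lemma Hplus_lmulE (h : H) (x : Hplus) :
  Hplus_incl (Hplus_lmul h x) = h * Hplus_incl x.
Proof. by rewrite linpackE. Qed.

Definition Hplus_act : {linear H \ox Hplus -> Hplus} :=
  tens_lift Hplus_lmul_bilin.

Lemma Hplus_actE (h : H) (x : Hplus) :
  Hplus_incl (Hplus_act (h \ot x)) = h * Hplus_incl x.
Proof. by rewrite tens_liftE. Qed.

Definition Hplus_mul : {linear Hplus \ox Hplus -> Hplus} :=
  lincomp Hplus_act (tmap Hplus_incl (linid Hplus)).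

Lemma Hplus_mulE (x y : Hplus) :
  Hplus_incl (Hplus_mul (x \ot y)) = Hplus_incl x * Hplus_incl y.
Proof. by rewrite lincompE tmapE Hplus_actE. Qed.

Definition is_fs_section (tau : {linear Hplus -> H \ox Hplus}) : Prop :=
  (forall (h : H) (x : Hplus),
     tau (Hplus_lmul h x) = tmap (lmul h) (linid Hplus) (tau x)) /\
  (forall x : Hplus, Hplus_act (tau x) = x).

(* the action of h on H^+ (x) H^+ is Hplus_lmul h (x) id *)
Definition Hplus_mul_has_section : Prop :=
  exists s : {linear Hplus -> Hplus \ox Hplus},
    (forall (h : H) (x : Hplus),
       s (Hplus_lmul h x) = tmap (Hplus_lmul h) (linid Hplus) (s x)) /\
    (forall x : Hplus, Hplus_mul (s x) = x).
End Augmentation.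

(* Main.v *)
From HB Require Import structures.
Require Import Defs.
From mathcomp Require Import all_boot all_algebra.
From mathcomp Require Import boolp classical_sets.

(* For a left H-module M, the twist a (x) m |-> a1 (x) a2 m is an H-linear isomorphism from
   the free module H (x) M (H acting on the left factor) to the diagonal one, inverted by
   the antipode.  It identifies the kernel of H (x) M -> M with H^+ (x) M under the diagonal
   action, and H (x) H^+ (x) M diagonal with a free module.  Hence an fs-section makes every
   H^+ (x) M relatively projective.  For M = H, where H^+ (x) H is Omega^1 H as a bimodule
   and as a comodule, this gives formal smoothness in both categories; for M = P/S, Schanuel's
   argument then gives the projectivity of S.  Conversely a bimodule splitting of
   (H (x) H^+) (x) H -> H^+ (x) H restricts along x |-> x (x) 1, followed by id (x) counit,
   to an fs-section.  In finite dimension, the identity of H, seen in H (x) H^*, is a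
   diagonal invariant, and untwisting it produces a nonzero left integral t; when H is
   hereditary K t is projective, which yields an integral l of counit 1, and
   x |-> x (x) (1 - l) splits the multiplication of H^+. *)

Set Implicit Arguments.
Unset Strict Implicit.
Unset Printing Implicit Defensive.

Import GRing.Theory.
Local Open Scope ring_scope.

(** * Linear sections and quotient modules *)

Section LinearSections.
Local Open Scope classical_set_scope.
Variables (K : fieldType) (X Y : lmodType K) (f : {linear X -> Y}).

(* Zorn provides a maximal subspace meeting the kernel of f trivially. *)
Let partial_complement (C : set X) :=
  (forall (a : K) x y, C x -> C y -> C (a *: x + y)) /\
  (forall x, C x -> f x = 0 -> x = 0).

Lemma exists_kernel_complement :
  (forall y, exists x, f x = y) ->
  exists2 C : set X, (forall (a : K) x y, C x -> C y -> C (a *: x + y)) &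
    forall y, exists! x, C x /\ f x = y.
Proof.
move=> f_surj.
have [|C [[C_lin C_ker] C_max]] := @Zorn_bigcup X partial_complement.
  move=> F FP Ftot; split=> [a x y [A FA Ax] [B FB By]|x [A FA Ax]]; last first.
    by have [_] := FP _ FA; apply.
  have [AB|BA] := Ftot _ _ FA FB; first exists B; rewrite //; last first.
    by exists A => //; have [+ _] := FP _ FA; apply=> //; apply: BA.
  by have [+ _] := FP _ FB; apply=> //; apply: AB.
have C_inj x y : C x -> C y -> f x = f y -> x = y.
  move=> Cx Cy fxy; apply/eqP; rewrite -subr_eq0; apply/eqP.
  rewrite addrC -scaleN1r; apply: C_ker; first exact: C_lin.
  by rewrite linearP /= fxy scaleN1r addNr.
exists C => // y.
suff [x [Cx fx]] : exists x, C x /\ f x = y.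
  by exists x; split=> // x' [Cx' fx']; apply: C_inj => //; rewrite fx.
have [x0 fx0] := f_surj y.
apply: contrapT => no_x.
(* The empty set also satisfies [partial_complement], so 0 in C comes from maximality: a nonempty C
   contains -x + x, and an empty one is enlarged by {0}. *)
have C0 : C 0.
  apply: contrapT => nC0; apply: (C_max [set 0]); last first.
    by split=> [a x z -> -> /=|x -> //]; rewrite scaler0 addr0.
  split=> [x Cx|/(_ 0 erefl)//].
  by case: nC0; rewrite -(addNr x) -scaleN1r; apply: C_lin.
(* Adjoining a preimage x0 of a missed y keeps the kernel condition: f(a x0 + c) = 0 with a nonzero
   would give y = f(-a^-1 c). *)
apply: (C_max [set z | exists a c, C c /\ z = a *: x0 + c]).
  split=> [c Cc|CC]; first by exists 0, c; rewrite scale0r add0r.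
  apply: no_x; exists x0; split=> //; apply: CC.
  by exists 1, 0; rewrite scale1r addr0.
split=> [b _ _ [a [c [Cc ->]]] [a' [c' [Cc' ->]]]|_ [a [c [Cc ->]]]].
  exists (b * a + a'), (b *: c + c'); split; first exact: C_lin.
  by rewrite scalerDr scalerA scalerDl addrACA.
rewrite linearP /= fx0; have [->|a0 e] := eqVneq a 0.
  by rewrite !scale0r !add0r; apply: C_ker.
case: no_x; exists (- a^-1 *: c); split.
  by rewrite -[_ *: c]addr0; apply: C_lin.
have fc : f c = - (a *: y) by apply/eqP; rewrite -addr_eq0 addrC e.
by rewrite linearZ /= fc scalerN scaleNr opprK scalerA mulVf // scale1r.
Qed.

(** Each vector has exactly one preimage in the complement C, and C is closed under linear
    combinations, so choosing that preimage is linear. *)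
Lemma surjective_linear_section :
  (forall y, exists x, f x = y) -> exists s : {linear Y -> X}, forall y, f (s y) = y.
Proof.
move=> /exists_kernel_complement [C C_lin Cex].
have [s Cs] := choice Cex.
have s_lin : linear s.
  move=> a y z; apply: (proj2 (Cs _)).
  have [[Cy fy] _] := Cs y; have [[Cz fz] _] := Cs z.
  by split; [exact: C_lin | rewrite linearP /= fy fz].
by exists (linpack s_lin) => y; rewrite linpackE; have [[]] := Cs y.
Qed.

End LinearSections.

Section QuotientModule.
Variables (R : pzRingType) (P : lmodType R) (S : submodClosed P).
Local Open Scope quotient_scope.

Lemma submodule_zmod_closed : zmod_closed (S : {pred P}).
Proof.
by split=> [|x y Sx Sy]; rewrite ?rpred0 // -scaleN1r rpredD // rpredZ.
Qed.

Let S_zmod : zmodClosed P :=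
  HB.pack (S : {pred P})
    (GRing.isZmodClosed.Build P (S : {pred P}) submodule_zmod_closed).

Definition quotient_module := Quotient.quot S_zmod.
HB.instance Definition _ := GRing.Zmodule.on quotient_module.

Definition quotient_proj (x : P) : quotient_module := \pi x.

Lemma quotient_projD : {morph quotient_proj : x y / x + y}.
Proof. by move=> x y; rewrite /quotient_proj !piE. Qed.

Lemma quotient_proj_surj y : exists x, quotient_proj x = y.
Proof. by exists (repr y); rewrite /quotient_proj reprK. Qed.

Lemma quotient_projP x y : quotient_proj x = quotient_proj y <-> x - y \in S.
Proof. by rewrite (Quotient.idealrBE S_zmod); split=> [/eqP|/eqP]. Qed.

Definition quotient_scale (a : R) (y : quotient_module) : quotient_module :=
  quotient_proj (a *: repr y).

Lemma quotient_scaleE a x : quotient_scale a (quotient_proj x) = quotient_proj (a *: x).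
Proof.
apply/quotient_projP; rewrite -scalerBr rpredZ //.
by apply/quotient_projP; rewrite /quotient_proj reprK.
Qed.

Lemma quotient_scaleA a b y :
  quotient_scale a (quotient_scale b y) = quotient_scale (a * b) y.
Proof. by have [x <-] := quotient_proj_surj y; rewrite !quotient_scaleE scalerA. Qed.
Lemma quotient_scale1 : left_id 1 quotient_scale.
Proof.
by move=> y; have [x <-] := quotient_proj_surj y; rewrite quotient_scaleE scale1r.
Qed.
Lemma quotient_scaleDr : right_distributive quotient_scale +%R.
Proof.
move=> a y z; have [x <-] := quotient_proj_surj y; have [w <-] := quotient_proj_surj z.
by rewrite -quotient_projD !quotient_scaleE scalerDr quotient_projD.
Qed.
Lemma quotient_scaleDl y : {morph quotient_scale^~ y : a b / a + b}.
Proof.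
move=> a b; have [x <-] := quotient_proj_surj y.
by rewrite !quotient_scaleE scalerDl quotient_projD.
Qed.
HB.instance Definition _ := GRing.Zmodule_isLmodule.Build R quotient_module
  quotient_scaleA quotient_scale1 quotient_scaleDr quotient_scaleDl.

Lemma quotient_proj_linear : linear quotient_proj.
Proof. by move=> a x y; rewrite quotient_projD -quotient_scaleE. Qed.
HB.instance Definition _ :=
  GRing.isLinear.Build R P quotient_module _ quotient_proj quotient_proj_linear.

End QuotientModule.

(** * Left H-modules over K and the twist H (x) M -> H (x) M *)

(* [tens_step] with enough rewriting rounds for the longer composites below. *)
Ltac tens_elim x :=
  let a := fresh "a" in let b := fresh "b" in
  let Ea := fresh "Ea" in let Eb := fresh "Eb" in
  elim/tens_ind: x => [|a b Ea Eb|];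
    [by do 20?tens_simp | do 20?tens_simp; first [by rewrite Ea Eb | by rewrite -Ea -Eb] | ].

Section Actions.
Variables (K : fieldType) (H : hopfAlgebra K).

(** A K-linear map out of H (x) V keeps the K-structure in sight and has the shape of the structure
    maps of bimodules in [vect_moncat]. *)
Record action := Action {
  act_car :> lmodType K;
  aop : {linear H \ox act_car -> act_car};
  aopA : forall h k v, aop (h \ot aop (k \ot v)) = aop ((h * k) \ot v);
  aop1 : forall v, aop (1 \ot v) = v
}.
End Actions.

Arguments aop {K H a}.
Notation "h |> v" := (aop (h \ot v)) (at level 40, left associativity).
Notation "h |>[ M ] v" := (@aop _ _ M (h \ot v))
  (at level 40, left associativity).

Section HopfModules.
Variables (K : fieldType) (H : hopfAlgebra K).
Implicit Types U W : lmodType K.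
Implicit Types M V : action H.

Definition equivariant V M (f : V -> M) : Prop :=
  forall h v, f (h |> v) = h |> f v.

Definition regular_action : action H.
Proof.
by refine (@Action _ H H (tmul H) _ _) => *; rewrite !tmulE (mulrA, mul1r).
Defined.

Definition free_op U : {linear H \ox (H \ox U) -> H \ox U} :=
  lincomp (tmap (tmul H) (linid U)) (tassocV H H U).

Lemma free_opE U h k u : free_op U (h \ot (k \ot u)) = (h * k) \ot u.
Proof. by rewrite lincompE tassocVE tmapE tmulE. Qed.

Definition free_action U : action H.
Proof.
refine (@Action _ H (H \ox U) (free_op U) _ _) => [h k z|z]; tens_elim z => l u.
  by rewrite !free_opE mulrA.
by rewrite free_opE mul1r.
Defined.

Lemma free_lmul U h (z : H \ox U) : tmap (lmul h) (linid U) z = h |>[free_action U] z.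
Proof. by tens_elim z => k u; rewrite /= free_opE tmapE linpackE. Qed.

(** Acting by an arbitrary element of H (x) H lets proofs replace a coproduct by a variable and
    check pure tensors. *)
Definition diag_opu V M : {linear (H \ox H) \ox (V \ox M) -> V \ox M} :=
  lincomp (tmap aop aop) (tmid H H V M).

Lemma diag_opuE V M h k (v : V) (m : M) :
  diag_opu V M ((h \ot k) \ot (v \ot m)) = (h |> v) \ot (k |> m).
Proof. by rewrite lincompE tmidE tmapE. Qed.

Definition diag_op V M : {linear H \ox (V \ox M) -> V \ox M} :=
  lincomp (diag_opu V M) (tmap (hcomul H) (linid (V \ox M))).

Lemma diag_opE V M h z : diag_op V M (h \ot z) = diag_opu V M (hcomul H h \ot z).
Proof. by rewrite lincompE tmapE. Qed.

Definition diag_action V M : action H.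
Proof.
refine (@Action _ H (V \ox M) (diag_op V M) _ _) => [h k z|z]; tens_elim z => v m.
  rewrite !diag_opE hcomulM; move: (hcomul H h) (hcomul H k) => a b.
  tens_elim a => h1 h2; tens_elim b => k1 k2.
  by rewrite tmidE tmapE !tmulE !diag_opuE !aopA.
by rewrite diag_opE hcomul1 diag_opuE !aop1.
Defined.

Lemma diagE V M h z : h |>[diag_action V M] z = diag_opu V M (hcomul H h \ot z).
Proof. exact: diag_opE. Qed.

Section Twist.
Variable M : action H.

Definition twist_map (g : {linear H \ox M -> M}) : {linear H \ox M -> H \ox M} :=
  lincomp (tmap (linid H) g) (lincomp (tassoc H H M) (tmap (hcomul H) (linid M))).

Definition twist : {linear H \ox M -> H \ox M} := twist_map aop.
Definition untwist : {linear H \ox M -> H \ox M} :=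
  twist_map (lincomp aop (tmap (hantipode H) (linid M))).

Lemma twist_mapE g h m :
  twist_map g (h \ot m) = tmap (linid H) g (tassoc H H M (hcomul H h \ot m)).
Proof. by rewrite !lincompE tmapE. Qed.

Lemma comulAV h :
  tmap (hcomul H) (linid H) (hcomul H h)
  = tassocV _ _ _ (tmap (linid H) (hcomul H) (hcomul H h)).
Proof.
rewrite -hcomulA; move: (tmap _ _ _) => a.
by tens_elim a => b k; tens_elim b => l1 l2; rewrite tassocE tassocVE.
Qed.

(* Both twist o untwist and untwist o twist send h (x) m to h1 (x) p(h2 (x) h3) m
   for p the left or right convolution of the identity with the antipode. *)
Lemma twist_mapK (g g' : {linear H \ox M -> M}) (p : {linear H \ox H -> H}) :
  (forall k l m, g (k \ot g' (l \ot m)) = p (k \ot l) |> m) ->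
  (forall h, p (hcomul H h) = (hcounit H h : K)%:A) ->
  forall z, twist_map g (twist_map g' z) = z.
Proof.
move=> gg' pD z; tens_elim z => h m.
rewrite twist_mapE.
have E (a : H \ox H) : twist_map g (tmap (linid H) g' (tassoc H H M (a \ot m)))
    = tmap (linid H) (lincomp aop (tmap p (linid M)))
       (tassoc _ _ _ (tassoc H H H (tmap (hcomul H) (linid H) a) \ot m)).
  tens_elim a => k l; rewrite tassocE !tmapE twist_mapE.
  move: (hcomul H k) => b; tens_elim b => k1 k2.
  by rewrite !(tassocE, tmapE, lincompE) gg'.
rewrite E hcomulA.
have E' (a : H \ox H) : tmap (linid H) (lincomp aop (tmap p (linid M)))
       (tassoc _ _ _ (tmap (linid H) (hcomul H) a \ot m))
    = tunitr H (tmap (linid H) (hcounit H) a) \ot m.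
  tens_elim a => k l; rewrite !(tassocE, tmapE, lincompE) pD tunitrE /=.
  by rewrite tensZl linearZZ aop1 tensZl tensZr.
by rewrite E' hcounitr.
Qed.

Lemma twistK z : untwist (twist z) = z.
Proof.
apply: (twist_mapK (p := lincomp (tmul H) (tmap (hantipode H) (linid H)))).
  by move=> k l m; rewrite !lincompE !tmapE tmulE aopA.
by move=> h; rewrite lincompE hantipodel.
Qed.

Lemma untwistK z : twist (untwist z) = z.
Proof.
apply: (twist_mapK (p := lincomp (tmul H) (tmap (linid H) (hantipode H)))).
  by move=> k l m; rewrite !lincompE !tmapE tmulE aopA.
by move=> h; rewrite lincompE hantipoder.
Qed.

(** Multiplicativity of the coproduct: both sides give h1 k1 (x) h2 k2 m. *)
Lemma twist_equivariant : @equivariant (free_action M) (diag_action regular_action M) twist.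
Proof.
move=> h z; rewrite diagE; tens_elim z => k m.
rewrite /= free_opE /twist !twist_mapE hcomulM.
move: (hcomul H h) (hcomul H k) => a b; tens_elim a => h1 h2; tens_elim b => k1 k2.
by rewrite !(tmapE, tmidE, tmulE, tassocE, diag_opuE) aopA.
Qed.

Lemma untwist_equivariant :
  @equivariant (diag_action regular_action M) (free_action M) untwist.
Proof.
by move=> h z; rewrite -{1}(untwistK z) -twist_equivariant twistK.
Qed.

End Twist.
End HopfModules.

(** * The kernel of the action map, and equivariant lifts from an fs-section *)

Section Lifting.
Variables (K : fieldType) (H : hopfAlgebra K).
Implicit Types (U W : lmodType K) (M V X Y : action H).

Lemma diag_map_equivariant V V' M M' (f : {linear V -> V'}) (g : {linear M -> M'}) :
  equivariant f -> equivariant g ->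
  @equivariant _ _ (diag_action V M) (diag_action V' M') (tmap f g).
Proof.
move=> fH gH h z; rewrite !diagE; tens_elim z => v m; rewrite tmapE.
move: (hcomul H h) => a; tens_elim a => h1 h2.
by rewrite !diag_opuE tmapE fH gH.
Qed.

Definition counit_left U : {linear H \ox U -> U} :=
  lincomp (tunitl U) (tmap (hcounit H) (linid U)).

Lemma counit_leftE U h u : counit_left U (h \ot u) = (hcounit H h : K) *: u.
Proof. by rewrite lincompE tmapE tunitlE. Qed.

(** The counit law. The twist thus turns the action into counit (x) id, whose kernel is H^+ (x)
    M. *)
Lemma counit_left_twist M z : counit_left M (twist M z) = aop z.
Proof.
tens_elim z => h m; rewrite twist_mapE -[in RHS](hcounitl h).
move: (hcomul H h) => a; tens_elim a => k l.
by rewrite tassocE !tmapE counit_leftE tunitlE tensZl linearZZ.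
Qed.

Lemma twist1 M m : twist M (1 \ot m) = 1 \ot m.
Proof. by rewrite twist_mapE hcomul1 tassocE tmapE aop1. Qed.

Definition Hplus_action : action H.
Proof.
refine (@Action _ H (Hplus H) (Hplus_act H) _ _) => [h k x|x]; apply: Hplus_incl_inj.
  by rewrite !Hplus_actE mulrA.
by rewrite Hplus_actE mul1r.
Defined.

Lemma Hplus_incl_equivariant : @equivariant _ _ Hplus_action (regular_action H) (Hplus_incl H).
Proof. by move=> h x; rewrite [LHS]Hplus_actE [RHS]tmulE. Qed.

Lemma Hplus_lmul_action h x : Hplus_lmul h x = h |>[Hplus_action] x.
Proof. by apply: Hplus_incl_inj; rewrite Hplus_lmulE [RHS]Hplus_actE. Qed.

Lemma counit_Hplus_incl (x : Hplus H) : hcounit H (Hplus_incl H x) = 0.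
Proof. by have := submod_valP x; rewrite inE => /eqP. Qed.

Lemma Hplus_proj_subproof (h : H) :
  h - (hcounit H h : K)%:A \in augmentation_subspace H.
Proof. by rewrite inE linearB linearZ /= hcounit1 [_ *: _]mulr1 subrr. Qed.

Definition Hplus_proj_fun (h : H) : Hplus H := Submodule (Hplus_proj_subproof h).

Lemma Hplus_proj_linear : linear Hplus_proj_fun.
Proof.
move=> a h k; apply: Hplus_incl_inj; rewrite linearP /=.
rewrite linearP scalerBr scalerDl scalerA opprD.
by rewrite addrACA.
Qed.

Definition Hplus_proj : {linear H -> Hplus H} := linpack Hplus_proj_linear.

Lemma Hplus_projE h : Hplus_incl H (Hplus_proj h) = h - (hcounit H h : K)%:A.
Proof. by rewrite linpackE. Qed.

Lemma Hplus_inclK x : Hplus_proj (Hplus_incl H x) = x.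
Proof.
by apply: Hplus_incl_inj; rewrite Hplus_projE counit_Hplus_incl scale0r subr0.
Qed.

Section ActionKernel.
Variable M : action H.

(* Through the twist, the kernel of the action H (x) M -> M becomes H^+ (x) M
   with the diagonal action. *)
Definition kerincl : {linear Hplus H \ox M -> H \ox M} :=
  lincomp (untwist M) (tmap (Hplus_incl H) (linid M)).
Definition kerproj : {linear H \ox M -> Hplus H \ox M} :=
  lincomp (tmap Hplus_proj (linid M)) (twist M).

Lemma kerinclE z : kerincl z = untwist M (tmap (Hplus_incl H) (linid M) z).
Proof. exact: lincompE. Qed.

Lemma kerprojE u : kerproj u = tmap Hplus_proj (linid M) (twist M u).
Proof. exact: lincompE. Qed.

Lemma kerinclK z : kerproj (kerincl z) = z.
Proof.
rewrite kerinclE kerprojE untwistK; tens_elim z => x m.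
by rewrite !tmapE Hplus_inclK.
Qed.

(** After the twist, which fixes 1 (x) m, projecting H to H^+ subtracts the counit part. With
    [kerincl_act], this makes the image of [kerincl] the kernel of the action. *)
Lemma kerprojK u : kerincl (kerproj u) = u - 1 \ot aop u.
Proof.
rewrite kerinclE kerprojE; apply: (can_inj (@twistK _ _ M)).
rewrite untwistK linearB /= twist1 -counit_left_twist.
elim/tens_ind: (twist M u) => [|a b Ea Eb|h m].
- by rewrite !linear0 tens0r subr0.
- by rewrite !linearD Ea Eb tensDr opprD addrACA.
by rewrite !tmapE Hplus_projE counit_leftE tensDl -scaleNr tensZl tensZr scaleNr.
Qed.

Lemma kerincl_act z : aop (kerincl z) = 0.
Proof.
rewrite -counit_left_twist kerinclE untwistK.
elim/tens_ind: z => [|a b Ea Eb|x m]; first by rewrite !linear0.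
  by rewrite !linearD Ea Eb addr0.
by rewrite tmapE counit_leftE counit_Hplus_incl scale0r.
Qed.

Lemma kerincl_equivariant :
  @equivariant _ _ (diag_action Hplus_action M) (free_action H M) kerincl.
Proof.
move=> h z; rewrite !kerinclE -untwist_equivariant.
congr (untwist M _); apply: (@diag_map_equivariant Hplus_action (regular_action H) M M) => //.
exact: Hplus_incl_equivariant.
Qed.

(** On the kernel of the action, [kerproj] is inverse to the equivariant [kerincl]; elsewhere the
    term 1 (x) aop u of [kerprojK] need not be equivariant. *)
Lemma kerproj_equivariant h u : aop u = 0 ->
  kerproj (h |>[free_action H M] u) = h |>[diag_action Hplus_action M] kerproj u.
Proof.
move=> u0; apply: (can_inj kerinclK).
rewrite kerincl_equivariant !kerprojK u0 tens0r subr0.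
suff -> : aop (h |>[free_action H M] u) = h |> aop u by rewrite u0 !(tens0r, linear0) addr0.
by clear u0; tens_elim u => k m; rewrite /= free_opE aopA.
Qed.

End ActionKernel.

Section Spread.
Variables (W : lmodType K) (M : action H).

Definition exchange U1 U2 U3 : {linear (U1 \ox U2) \ox U3 -> (U1 \ox U3) \ox U2} :=
  lincomp (tassocV U1 U3 U2)
    (lincomp (tmap (linid U1) (tswap U2 U3)) (tassoc U1 U2 U3)).

Lemma exchangeE U1 U2 U3 (u1 : U1) (u2 : U2) (u3 : U3) :
  exchange U1 U2 U3 ((u1 \ot u2) \ot u3) = (u1 \ot u3) \ot u2.
Proof. by rewrite !(lincompE, tassocE, tmapE, tswapE, tassocVE). Qed.

Definition spreadV : {linear (H \ox M) \ox W -> H \ox (W \ox M)} :=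
  lincomp (tassoc H W M) (exchange H M W).

(* (h (x) w) (x) m |-> h1 (x) (w (x) S(h2) m) *)
Definition spread : {linear (H \ox W) \ox M -> H \ox (W \ox M)} :=
  lincomp spreadV
    (lincomp (tmap (untwist M) (linid W)) (exchange H W M)).

Lemma spreadVE h m w : spreadV ((h \ot m) \ot w) = h \ot (w \ot m).
Proof. by rewrite [LHS]lincompE exchangeE tassocE. Qed.

Lemma spreadE h w m : spread ((h \ot w) \ot m) = spreadV (untwist M (h \ot m) \ot w).
Proof.
rewrite [LHS]lincompE; congr (spreadV _).
by rewrite [LHS]lincompE exchangeE tmapE.
Qed.

Lemma spread_equivariant :
  @equivariant _ _ (diag_action (free_action H W) M) (free_action H (W \ox M)) spread.
Proof.
move=> h z; rewrite diagE; tens_elim z => y m; tens_elim y => k w.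
rewrite spreadE.
have -> : spread (diag_opu (free_action H W) M (hcomul H h \ot ((k \ot w) \ot m)))
    = spreadV (untwist M (h |>[diag_action (regular_action H) M] (k \ot m)) \ot w).
  rewrite diagE; move: (hcomul H h) => a; tens_elim a => h1 h2.
  by rewrite !diag_opuE /= free_opE tmulE spreadE.
rewrite untwist_equivariant; move: (untwist M _) => u; tens_elim u => l n.
by rewrite !(free_opE, spreadVE).
Qed.

End Spread.

(** The left side is h1 v (x) h2 S(h3) m, where the antipode cancels. The proof obtains the
    cancellation by writing h (x) m as the twist of its untwist. *)
Lemma spread_diag V M (v : V) (m : M) h :
  @aop _ _ (diag_action V M) (spread V M ((h \ot v) \ot m)) = (h |> v) \ot m.
Proof.
rewrite spreadE.
have -> : (h |> v) \ot m
    = tmap aop (linid M) (exchange H M V (twist M (untwist M (h \ot m)) \ot v)).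
  by rewrite untwistK exchangeE tmapE.
move: (untwist M _) => u; tens_elim u => k n.
rewrite spreadVE diagE twist_mapE.
move: (hcomul H k) => a; tens_elim a => k1 k2.
by rewrite diag_opuE tassocE !(tmapE, exchangeE).
Qed.

Section FsLift.
Variable tau : {linear Hplus H -> H \ox Hplus H}.
Hypothesis tauP : is_fs_section tau.

Lemma tau_equivariant : @equivariant _ _ Hplus_action (free_action H (Hplus H)) tau.
Proof.
by move=> h x; rewrite -free_lmul -tauP.1 Hplus_lmul_action.
Qed.

Variables (M X : action H) (phi : {linear Hplus H \ox M -> X}).

(** If tau x is the sum of a (x) b, then x (x) m goes to the sum of a1 phi(b (x) S(a2) m): the
    fs-section averages a K-linear phi into an H-linear map. *)
Definition fs_lift : {linear Hplus H \ox M -> X} :=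
  lincomp (lincomp aop (tmap (linid H) phi))
    (lincomp (spread (Hplus H) M) (tmap tau (linid M))).

Lemma fs_liftE z : fs_lift z =
  aop (tmap (linid H) phi (spread (Hplus H) M (tmap tau (linid M) z))).
Proof.
rewrite [LHS]lincompE [LHS]lincompE; congr (aop (tmap _ _ _)).
exact: lincompE.
Qed.

Lemma fs_lift_equivariant : @equivariant _ _ (diag_action Hplus_action M) X fs_lift.
Proof.
move=> h z; rewrite !fs_liftE.
rewrite (@diag_map_equivariant Hplus_action (free_action H (Hplus H)) M M tau (linid M)
  tau_equivariant) // spread_equivariant.
move: (spread _ _ _) => u; tens_elim u => k w.
by rewrite /= free_opE !tmapE aopA.
Qed.

(** Equivariance of f and g turns f(a1 phi(b (x) S(a2) m)) into g(a1 b (x) a2 S(a3) m) = g(ab (x)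
    m), and the products ab sum to x. *)
Lemma fs_lift_factor Y (f : {linear X -> Y}) (g : {linear Hplus H \ox M -> Y}) :
  equivariant f -> @equivariant _ _ (diag_action Hplus_action M) Y g ->
  (forall z, f (phi z) = g z) -> forall z, f (fs_lift z) = g z.
Proof.
move=> fH gH fphi z; rewrite fs_liftE.
have E u : f (aop (tmap (linid H) phi u))
           = g (@aop _ _ (diag_action Hplus_action M) u).
  tens_elim u => k w.
  by rewrite tmapE fH fphi gH.
rewrite E; congr (g _); tens_elim z => x m.
rewrite tmapE -[in RHS](tauP.2 x).
move: (tau x) => y; tens_elim y => h w.
by rewrite spread_diag.
Qed.

End FsLift.
End Lifting.

(** * Uniqueness of Omega^1 *)

Section Omega1Uniqueness.
Local Open Scope moncat_scope.
Variables (M : moncat) (A : malgebra M).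
Implicit Types N X Y Z : mbimodule A.

Lemma kernel_mono (L X Y Z : M) (i : mhom L X) (f : mhom X Y) (h h' : mhom Z L) :
  is_kernel i f -> i \cm h = i \cm h' -> h = h'.
Proof.
move=> [fi0 i_univ] hh'.
have [|w [_ w_uniq]] := i_univ _ (i \cm h); first by rewrite Defs.compA fi0 comp0m.
by rewrite -(w_uniq h erefl) (w_uniq h' (esym hh')).
Qed.

Lemma mtensm_compl (X Y Z T : M) (g : mhom Y Z) (f : mhom X Y) :
  idm T \xm (g \cm f) = (idm T \xm g) \cm (idm T \xm f).
Proof. by rewrite -mtensm_comp comp1m. Qed.

Lemma mtensm_compr (X Y Z T : M) (g : mhom Y Z) (f : mhom X Y) :
  (g \cm f) \xm idm T = (g \xm idm T) \cm (f \xm idm T).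
Proof. by rewrite -mtensm_comp comp1m. Qed.

Lemma bimod_hom_id X : bimod_hom (idm X).
Proof. by split; rewrite mtensm1 comp1m compm1. Qed.

Lemma bimod_hom_comp X Y Z (g : mhom Y Z) (f : mhom X Y) :
  bimod_hom g -> bimod_hom f -> bimod_hom (g \cm f).
Proof.
move=> [gl gr] [fl fr]; split.
  by rewrite -Defs.compA fl Defs.compA gl -Defs.compA mtensm_compl.
by rewrite -Defs.compA fr Defs.compA gr -Defs.compA mtensm_compr.
Qed.

(** The kernel property of i' induces the map, and it is bimodule linear because i' is mono. *)
Lemma Omega1_hom N N' (i : mhom N (A \xx A)) (i' : mhom N' (A \xx A)) :
  is_Omega1 i -> is_Omega1 i' ->
  exists2 u : mhom N N', bimod_hom u & i' \cm u = i.
Proof.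
move=> [[mi0 _] il ir] [ker_i' il' ir'].
have [u [iu _]] := ker_i'.2 _ i mi0.
exists u => //; split; apply: (kernel_mono ker_i').
  by rewrite Defs.compA iu il Defs.compA il' -!Defs.compA -iu mtensm_compl.
by rewrite Defs.compA iu ir Defs.compA ir' -!Defs.compA -iu mtensm_compr.
Qed.

Lemma Omega1_E_projective N N' (i : mhom N (A \xx A)) (i' : mhom N' (A \xx A)) :
  is_Omega1 i -> is_Omega1 i' -> E_projective N -> E_projective N'.
Proof.
move=> Oi Oi' projN X Y f fB fs g gB.
have [u uB iu] := Omega1_hom Oi' Oi; have [v vB iv] := Omega1_hom Oi Oi'.
have [h hB fh] := projN X Y f fB fs (g \cm v) (bimod_hom_comp gB vB).
exists (h \cm u); first exact: bimod_hom_comp.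
rewrite Defs.compA fh -Defs.compA (_ : v \cm u = idm N') ?compm1 //.
by case: Oi' => ker_i' _ _; apply: (kernel_mono ker_i'); rewrite Defs.compA iv iu compm1.
Qed.

(** Smoothness can thus be tested on one convenient realisation of Omega^1, below H^+ (x) H. *)
Lemma formally_smoothP N (i : mhom N (A \xx A)) :
  is_Omega1 i -> formally_smooth A <-> E_projective N.
Proof.
move=> Oi; split=> [[N' [i' [Oi' projN']]]|projN]; last by exists N, i.
exact: Omega1_E_projective Oi' Oi projN'.
Qed.

End Omega1Uniqueness.

(** * Hopf bimodules V (x) H *)

Section HopfBimodules.
Variables (K : fieldType) (H : hopfAlgebra K).
Implicit Types (U W : lmodType K) (V : action H).

Definition tensl U W (u : U) : {linear W -> U \ox W} :=
  linpack ((tens_bilin U W).2 u).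

Lemma tenslE U W (u : U) (w : W) : tensl W u w = u \ot w.
Proof. exact: linpackE. Qed.

Definition rmul_op U : {linear (U \ox H) \ox H -> U \ox H} :=
  lincomp (tmap (linid U) (tmul H)) (tassoc U H H).

Lemma rmul_opE U (u : U) h k : rmul_op U ((u \ot h) \ot k) = u \ot (h * k).
Proof. by rewrite lincompE tassocE tmapE tmulE. Qed.

Definition cofree_coact U : {linear U \ox H -> (U \ox H) \ox H} :=
  lincomp (tassocV U H H) (tmap (linid U) (hcomul H)).

Lemma cofree_coactE U (u : U) h :
  cofree_coact U (u \ot h) = tmap (tensl H u) (linid H) (hcomul H h).
Proof.
rewrite lincompE tmapE; move: (hcomul H h) => a.
by tens_elim a => k l; rewrite tassocVE tmapE tenslE.
Qed.

Lemma cofree_coactA U z :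
  tassoc _ _ _ (tmap (cofree_coact U) (linid H) (cofree_coact U z))
  = tmap (linid (U \ox H)) (hcomul H) (cofree_coact U z).
Proof.
tens_elim z => u h; rewrite !cofree_coactE.
have -> : tmap (linid (U \ox H)) (hcomul H) (tmap (tensl H u) (linid H) (hcomul H h))
    = tmap (tensl H u) (linid _) (tmap (linid H) (hcomul H) (hcomul H h)).
  by move: (hcomul H h) => a; tens_elim a => k l; rewrite !tmapE.
rewrite -hcomulA; move: (hcomul H h) => a; tens_elim a => k l.
rewrite !tmapE tenslE cofree_coactE.
by move: (hcomul H k) => b; tens_elim b => b1 b2; rewrite !(tmapE, tassocE).
Qed.

Lemma cofree_coact1 U z :
  tunitr _ (tmap (linid (U \ox H)) (hcounit H) (cofree_coact U z)) = z.
Proof.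
tens_elim z => u h; rewrite cofree_coactE -[in RHS](hcounitr h).
move: (hcomul H h) => a; tens_elim a => k l.
by rewrite !(tmapE, tunitrE) tenslE tensZr.
Qed.

Definition cofree U : comodule H := Comodule (@cofree_coactA U) (@cofree_coact1 U).

Lemma cofree_map_colin U W (f : {linear U -> W}) z :
  cofree_coact W (tmap f (linid H) z) = tmap (tmap f (linid H)) (linid H) (cofree_coact U z).
Proof.
tens_elim z => u h; rewrite tmapE !cofree_coactE.
move: (hcomul H h) => a; tens_elim a => k l.
by rewrite !tmapE !tenslE tmapE.
Qed.

(** Both sides are h1 v (x) h2 k1 (x) h3 k2, read through the two bracketings of the iterated
    coproduct of h. *)
Lemma diag_colin V z :
  cofree_coact V (diag_op V (regular_action H) z)
  = tmap (diag_op V (regular_action H)) (linid H)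
      (codiag (regular_comodule H) (cofree V) z).
Proof.
tens_elim z => h y; tens_elim y => v k.
rewrite codiagE /= cofree_coactE diag_opE.
(* G is that common value, with t standing for h1 (x) h2 (x) h3. *)
pose G (t : H \ox (H \ox H)) := tmap (diag_opu V (regular_action H)) (tmul H)
  (tmid _ _ _ _ (tassocV _ _ _ t \ot tmap (tensl H v) (linid H) (hcomul H k))).
have E1 (a : H \ox H) : cofree_coact V (diag_opu V (regular_action H) (a \ot (v \ot k)))
    = G (tmap (linid H) (hcomul H) a).
  rewrite {}/G; tens_elim a => h1 h2.
  rewrite diag_opuE /= cofree_coactE tmulE hcomulM tmapE.
  move: (hcomul H h2) (hcomul H k) => b c.
  tens_elim b => b1 b2; tens_elim c => c1 c2.
  by rewrite !(tassocVE, tmidE, tmapE, tmulE) !tenslE diag_opuE /= tmulE.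
rewrite E1 -hcomulA /G; move: (hcomul H h) (hcomul H k) => a c.
tens_elim a => h1 h2; tens_elim c => c1 c2.
rewrite !tmapE tenslE codiag_mapE tmapE diag_opE.
move: (hcomul H h1) => b; tens_elim b => b1 b2.
by rewrite tassocE tassocVE tmidE tmapE tmulE.
Qed.

Lemma rmul_colin U z :
  cofree_coact U (rmul_op U z)
  = tmap (rmul_op U) (linid H) (codiag (cofree U) (regular_comodule H) z).
Proof.
tens_elim z => y k; tens_elim y => u h.
rewrite codiagE rmul_opE /= !cofree_coactE hcomulM.
move: (hcomul H h) (hcomul H k) => a c.
tens_elim a => a1 a2; tens_elim c => c1 c2.
by rewrite tmidE !tmapE !tmulE !tenslE codiag_mapE tmapE rmul_opE.
Qed.

(** For M = H the twist sends h (x) k to h acting diagonally on 1 (x) k, which reduces the claim to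
    [diag_colin]. *)
Lemma twist_colin z :
  cofree_coact H (twist (regular_action H) z)
  = tmap (twist (regular_action H)) (linid H)
      (codiag (regular_comodule H) (regular_comodule H) z).
Proof.
have E y : twist (regular_action H) y
    = diag_op (regular_action H) (regular_action H) (tmap (linid H) (tensl H 1) y).
  tens_elim y => h k; rewrite twist_mapE tmapE tenslE diag_opE.
  move: (hcomul H h) => a; tens_elim a => a1 a2.
  by rewrite tassocE tmapE diag_opuE /= !tmulE mulr1.
rewrite E [LHS](@diag_colin (regular_action H)); tens_elim z => h k.
rewrite tmapE !codiagE /= tenslE cofree_coactE.
move: (hcomul H h) (hcomul H k) => a b.
tens_elim a => a1 a2; tens_elim b => b1 b2.
by rewrite !(tmapE, codiag_mapE) E tmapE.
Qed.

Lemma untwist_colin z :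
  codiag (regular_comodule H) (regular_comodule H) (untwist (regular_action H) z)
  = tmap (untwist (regular_action H)) (linid H) (cofree_coact H z).
Proof.
rewrite -{2}(untwistK z) twist_colin.
move: (codiag _ _ _) => u; tens_elim u => y h.
by rewrite !tmapE twistK.
Qed.

Lemma untwist_rmul z h :
  untwist (regular_action H) (rmul_op H (z \ot h))
  = rmul_op H (untwist (regular_action H) z \ot h).
Proof.
tens_elim z => k l; rewrite rmul_opE !twist_mapE.
move: (hcomul H k) => a; tens_elim a => a1 a2.
by rewrite !tassocE !tmapE rmul_opE !lincompE !tmapE /= !tmulE mulrA.
Qed.

Lemma kerincl_rmul z h :
  kerincl (regular_action H) (rmul_op (Hplus H) (z \ot h))
  = rmul_op H (kerincl (regular_action H) z \ot h).
Proof.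
rewrite !kerinclE -untwist_rmul; congr (untwist _ _).
by tens_elim z => x k; rewrite tmapE !rmul_opE tmapE.
Qed.

Lemma kerincl_colin z :
  codiag (regular_comodule H) (regular_comodule H) (kerincl (regular_action H) z)
  = tmap (kerincl (regular_action H)) (linid H) (cofree_coact (Hplus H) z).
Proof.
rewrite kerinclE untwist_colin cofree_map_colin tmap_comp.
congr (tmap _ _ _); by apply: linP => y; rewrite lincompE.
Qed.

Lemma kerproj_colin z :
  cofree_coact (Hplus H) (kerproj (regular_action H) z)
  = tmap (kerproj (regular_action H)) (linid H)
      (codiag (regular_comodule H) (regular_comodule H) z).
Proof.
rewrite kerprojE cofree_map_colin twist_colin tmap_comp.
congr (tmap _ _ _); by apply: linP => y; rewrite lincompE.
Qed.

End HopfBimodules.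

(** * Bimodules in vector spaces, and Omega^1 H as H^+ (x) H *)

Section Bimodules.
Variables (K : fieldType) (H : hopfAlgebra K).
Implicit Types (V W : action H) (X Y : mbimodule (vect_algebra H)).

(** [vact] and [vract] restate the structure maps with explicit linear types, so that they can be
    evaluated on elements. *)
Definition vact X : {linear H \ox (bcar X : lmodType K) -> (bcar X : lmodType K)} :=
  lact X.
Definition vract X : {linear (bcar X : lmodType K) \ox H -> (bcar X : lmodType K)} :=
  ract X.

Definition bimod_action X : action H.
Proof.
refine (@Action _ H (bcar X : lmodType K) (vact X) _ _) => [h k x|x].
  have /(congr1 (fun g : {linear _ -> _} => g ((h \ot k) \ot x))) := lactA X.
  by rewrite !(lincompE, tmapE, tassocE) /= tmulE => ->.
have /(congr1 (fun g : {linear _ -> _} => g ((1 : K^o) \ot x))) := lact1 X.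
by rewrite lincompE tmapE tunitlE /= toneE !scale1r.
Defined.

Lemma vractA X (x : bimod_action X) h k :
  vract X (vract X (x \ot h) \ot k) = vract X (x \ot (h * k)).
Proof.
have /(congr1 (fun g : {linear _ -> _} => g ((x \ot h) \ot k))) := ractA X.
by rewrite !(lincompE, tmapE, tassocE) /= tmulE.
Qed.

Lemma vact_ract X h (x : bimod_action X) k :
  vract X ((h |> x) \ot k) = h |>[bimod_action X] vract X (x \ot k).
Proof.
have /(congr1 (fun g : {linear _ -> _} => g ((h \ot x) \ot k))) := lractA X.
by rewrite !(lincompE, tmapE, tassocE).
Qed.

Lemma bimod_homP X Y (f : {linear bimod_action X -> bimod_action Y}) :
  @bimod_hom _ _ X Y f <->
  equivariant f /\ forall x h, f (vract X (x \ot h)) = vract Y (f x \ot h).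
Proof.
split=> [[fl fr]|[fl fr]]; split.
- move=> h x; have /(congr1 (fun g : {linear _ -> _} => g (h \ot x))) := fl.
  by rewrite !lincompE tmapE.
- move=> x h; have /(congr1 (fun g : {linear _ -> _} => g (x \ot h))) := fr.
  by rewrite !lincompE tmapE.
- by apply/linP/tens_ext => h x; rewrite !lincompE tmapE; exact: fl.
- by apply/linP/tens_ext => x h; rewrite !lincompE tmapE; exact: fr.
Qed.

(** V = H^+ gives Omega^1 H, and V = H (x) H^+ with the free action gives the bimodule that is
    mapped onto it. *)
Definition hopf_bimod V : mbimodule (vect_algebra H).
Proof.
refine (@MBimodule (vect_moncat K) (vect_algebra H) (V \ox H : lmodType K)
  (diag_op V (regular_action H)) (rmul_op H V) _ _ _ _ _).
- apply/linP/tens_ext => x z; rewrite [LHS]lincompE [RHS]lincompE [RHS]lincompE.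
  tens_elim x => h k; rewrite tassocE !tmapE tmulE.
  by symmetry; exact: (@aopA _ _ (diag_action V (regular_action H))).
- apply/linP/tens_ext => a z; rewrite [LHS]lincompE tmapE tunitlE toneE tensZl.
  by rewrite linearZZ; congr (_ *: _); exact: (@aop1 _ _ (diag_action V (regular_action H))).
- apply/linP/tens_ext => x k; rewrite [LHS]lincompE [RHS]lincompE [RHS]lincompE.
  tens_elim x => z h; tens_elim z => v l.
  by rewrite tassocE !tmapE !rmul_opE tmulE mulrA.
- apply/linP/tens_ext => z a; rewrite [LHS]lincompE tmapE tunitrE toneE tensZr.
  by rewrite linearZZ; congr (_ *: _); tens_elim z => v l; rewrite rmul_opE mulr1.
apply/linP/tens_ext => x k; rewrite [LHS]lincompE [RHS]lincompE [RHS]lincompE.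
tens_elim x => h z; tens_elim z => v l; rewrite tassocE !tmapE rmul_opE !diag_opE.
move: (hcomul H h) => a; tens_elim a => a1 a2.
by rewrite !diag_opuE rmul_opE /= !tmulE mulrA.
Defined.

Lemma hopf_bimod_map V W (f : {linear V -> W}) :
  equivariant f -> @bimod_hom _ _ (hopf_bimod V) (hopf_bimod W) (tmap f (linid H)).
Proof.
move=> fH; apply/bimod_homP; split.
  by apply: (@diag_map_equivariant _ _ V W (regular_action H) (regular_action H)).
move=> x k /=; tens_elim x => v h.
by rewrite tmapE !rmul_opE tmapE.
Qed.

End Bimodules.

Section Omega1.
Variables (K : fieldType) (H : hopfAlgebra K).

(** [kerproj] supplies the factorisation through the kernel by [kerprojK], and [kerinclK] its
    uniqueness. *)
Lemma hopf_bimod_Omega1 :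
  @is_Omega1 _ _ (hopf_bimod (Hplus_action H)) (kerincl (regular_action H)).
Proof.
split.
- split.
    apply: linP => z; rewrite [LHS]lincompE.
    by change (aop (kerincl (regular_action H) z) = (0 : H)); rewrite kerincl_act.
  move=> Z g mg0; exists (lincomp (kerproj (regular_action H)) g); split.
    apply: linP => z; rewrite [LHS]lincompE (lincompE (kerproj (regular_action H)) g z).
    rewrite [LHS]kerprojK.
    have /(congr1 (fun f : {linear _ -> _} => f z)) := mg0.
    by rewrite lincompE => ->; rewrite tens0r subr0.
  move=> h <-; apply: linP => z; rewrite [LHS]lincompE.
  by rewrite (lincompE (kerincl (regular_action H)) h z) kerinclK.
- apply: linP => z; rewrite [RHS]lincompE [RHS]lincompE [LHS]lincompE.
  elim/tens_ind: z => [|x y Ex Ey|h z].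
  + by rewrite !linear0.
  + by rewrite !linearD Ex Ey.
  apply: (etrans (@kerincl_equivariant _ _ (regular_action H) h z)).
  by rewrite tmapE [LHS]lincompE.
apply: linP => z; rewrite [RHS]lincompE [RHS]lincompE [LHS]lincompE.
elim/tens_ind: z => [|x y Ex Ey|z h].
- by rewrite !linear0.
- by rewrite !linearD Ex Ey.
apply: (etrans (kerincl_rmul z h)).
by rewrite tmapE [LHS]lincompE.
Qed.

End Omega1.

(** * Right linearity and colinearity of the lifts, and fs-sections from bimodule sections *)

Section BimoduleLifting.
Variables (K : fieldType) (H : hopfAlgebra K).
Implicit Types (U W : lmodType K) (V : action H).

Definition tensr U W (w : W) : {linear U -> U \ox W} :=
  linpack ((tens_bilin U W).1 w).

Lemma tensrE U W (u : U) (w : W) : tensr U w u = u \ot w.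
Proof. exact: linpackE. Qed.

Lemma spread_rmul W z h :
  spread W (regular_action H) (rmul_op H (H \ox W) (z \ot h))
  = tmap (linid H) (lincomp (rmul_op H W) (tensr (W \ox H) h)) (spread W (regular_action H) z).
Proof.
tens_elim z => y k; tens_elim y => l w.
rewrite rmul_opE !spreadE.
have -> : untwist (regular_action H) (l \ot (k * h))
    = rmul_op H H (untwist (regular_action H) (l \ot k) \ot h).
  by rewrite -untwist_rmul rmul_opE.
move: (untwist _ _) => u; tens_elim u => u1 u2.
by rewrite rmul_opE !spreadVE tmapE lincompE tensrE rmul_opE.
Qed.

(** [spread] carries W along inertly, which leaves [untwist_colin] on the two factors H. *)
Lemma spread_colin W z :
  codiag (regular_comodule H) (cofree H W) (spread W (regular_action H) z)
  = tmap (spread W (regular_action H)) (linid H) (cofree_coact H (H \ox W) z).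
Proof.
tens_elim z => y k; tens_elim y => l w.
rewrite spreadE.
have E u : codiag (regular_comodule H) (cofree H W) (spreadV W (regular_action H) (u \ot w))
    = tmap (lincomp (spreadV W (regular_action H)) (tensr _ w)) (linid H)
        (codiag (regular_comodule H) (regular_comodule H) u).
  tens_elim u => h1 h2; rewrite spreadVE !codiagE /= cofree_coactE.
  move: (hcomul H h1) (hcomul H h2) => a b.
  tens_elim a => a1 a2; tens_elim b => b1 b2.
  by rewrite !(tmapE, codiag_mapE) lincompE tensrE tenslE spreadVE.
rewrite E untwist_colin !cofree_coactE.
move: (hcomul H k) => a; tens_elim a => a1 a2.
by rewrite !tmapE !tenslE lincompE tensrE spreadE.
Qed.

Section Lift.
Variable tau : {linear Hplus H -> H \ox Hplus H}.
Variables (X : mbimodule (vect_algebra H)) (phi : {linear Hplus H \ox H -> bimod_action X}).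

Lemma fs_lift_rmul :
  (forall z h, phi (rmul_op H (Hplus H) (z \ot h)) = vract X (phi z \ot h)) ->
  forall z h, @fs_lift _ _ tau (regular_action H) (bimod_action X) phi
                 (rmul_op H (Hplus H) (z \ot h))
              = vract X (@fs_lift _ _ tau (regular_action H) (bimod_action X) phi z \ot h).
Proof.
move=> phiR z h; rewrite !fs_liftE.
have -> : tmap tau (linid H) (rmul_op H (Hplus H) (z \ot h))
    = rmul_op H (H \ox Hplus H) (tmap tau (linid H) z \ot h).
  by tens_elim z => x k; rewrite !(rmul_opE, tmapE).
rewrite spread_rmul; move: (spread _ _ _) => u; tens_elim u => k w.
by rewrite !tmapE lincompE tensrE phiR -vact_ract.
Qed.

End Lift.

Definition counit_right U : {linear U \ox H -> U} :=
  lincomp (tunitr U) (tmap (linid U) (hcounit H)).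

Lemma counit_rightE U (u : U) h : counit_right U (u \ot h) = (hcounit H h : K) *: u.
Proof. by rewrite [LHS]lincompE tmapE tunitrE. Qed.

Lemma counit_right_diag V h z :
  counit_right V (diag_op V (regular_action H) (h \ot z)) = h |> counit_right V z.
Proof.
tens_elim z => v k; rewrite diag_opE -[in RHS](hcounitr h).
move: (hcomul H h) => a; tens_elim a => a1 a2.
rewrite diag_opuE /= tmulE !counit_rightE tmapE tunitrE hcounitM /=.
by rewrite tensZl tensZr 2!linearZZ scalerA.
Qed.

Lemma counit_right_rmul U z h :
  counit_right U (rmul_op H U (z \ot h)) = (hcounit H h : K) *: counit_right U z.
Proof.
elim/tens_ind: z => [|a b Ea Eb|u k].
- by rewrite !(tens0l, linear0).
- by rewrite tensDl !linearD Ea Eb.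
by rewrite rmul_opE !counit_rightE hcounitM scalerA mulrC.
Qed.

(** This encodes that the counit absorbs the antipode: the twist preserves id (x) counit, hence so
    does its inverse. *)
Lemma counit_right_untwist h : counit_right H (untwist (regular_action H) (h \ot 1)) = h.
Proof.
have E u : counit_right H (twist (regular_action H) u) = counit_right H u.
  tens_elim u => k l; rewrite twist_mapE -[in RHS](hcounitr k).
  move: (hcomul H k) => a; tens_elim a => a1 a2.
  rewrite tassocE !tmapE tunitrE tmulE !counit_rightE hcounitM /=.
  by rewrite scalerA mulrC.
by rewrite -E untwistK counit_rightE hcounit1 scale1r.
Qed.

Lemma Hplus_act_equivariant :
  @equivariant _ _ (free_action H (Hplus H)) (Hplus_action H) (Hplus_act H).
Proof.
move=> h z; tens_elim z => k x; rewrite /= free_opE.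
by symmetry; exact: (@aopA _ _ (Hplus_action H)).
Qed.

(** The witness is x |-> (id (x) counit)(h(x (x) 1)). *)
Lemma bimod_section_fs
    (h : {linear Hplus H \ox H -> (H \ox Hplus H) \ox H}) :
  @bimod_hom _ _ (hopf_bimod (Hplus_action H)) (hopf_bimod (free_action H (Hplus H))) h ->
  (forall z, tmap (Hplus_act H) (linid H) (h z) = z) ->
  exists tau : {linear Hplus H -> H \ox Hplus H}, is_fs_section tau.
Proof.
move=> /bimod_homP [hl hr] hK.
exists (lincomp (counit_right (H \ox Hplus H)) (lincomp h (tensr (Hplus H) (1 : H)))).
have E x : lincomp (counit_right (H \ox Hplus H))
      (lincomp h (tensr (Hplus H) (1 : H))) x = counit_right _ (h (x \ot 1)).
  by rewrite [LHS]lincompE; congr (counit_right _ _); rewrite [LHS]lincompE tensrE.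
split=> [k x|x]; rewrite !E.
  rewrite Hplus_lmul_action free_lmul.
  (* Diagonally, k sends x (x) 1 to k1 x (x) k2, not to kx (x) 1. The latter is the sum of k1 (x (x)
     S(k2)), from which right linearity of h extracts S(k2) for the counit to absorb. *)
  rewrite -(spread_diag (V := Hplus_action H) (M := regular_action H) x 1 k) spreadE.
  rewrite -[in RHS](counit_right_untwist k).
  move: (untwist _ _) => u; tens_elim u => a b.
  rewrite spreadVE hl.
  have -> : x \ot b = rmul_op H (Hplus H) ((x \ot 1) \ot b) by rewrite rmul_opE mul1r.
  rewrite hr [LHS]counit_right_diag counit_right_rmul counit_rightE.
  by rewrite tensZl tensZr.
have F z : Hplus_act H (counit_right _ z) = counit_right _ (tmap (Hplus_act H) (linid H) z).
  by tens_elim z => y k; rewrite tmapE !counit_rightE linearZZ.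
by rewrite F hK counit_rightE hcounit1 scale1r.
Qed.

End BimoduleLifting.

(** * Formal smoothness in vector spaces *)

Section VectSmoothness.
Variables (K : fieldType) (H : hopfAlgebra K).

Lemma act_unit_section z :
  tmap (Hplus_act H) (linid H) (tmap (tensl (Hplus H) (1 : H)) (linid H) z) = z.
Proof.
tens_elim z => x h; rewrite !tmapE tenslE; congr (_ \ot _).
exact: (@aop1 _ _ (Hplus_action H)).
Qed.

(** Projectivity lifts the identity of Omega^1 H through the action H (x) H^+ -> H^+ tensored with
    H, which x |-> 1 (x) x splits linearly. *)
Lemma vect_smooth_fs : formally_smooth (vect_algebra H) ->
  exists tau : {linear Hplus H -> H \ox Hplus H}, is_fs_section tau.
Proof.
move/(formally_smoothP (hopf_bimod_Omega1 H)) => proj.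
pose f : mhom (hopf_bimod (free_action H (Hplus H))) (hopf_bimod (Hplus_action H)) :=
  tmap (Hplus_act H) (linid H).
have fB : bimod_hom f by exact: (hopf_bimod_map (@Hplus_act_equivariant _ H)).
have fs : has_section f.
  exists (tmap (tensl (Hplus H) (1 : H)) (linid H)).
  by apply: linP => z; rewrite [LHS]lincompE act_unit_section.
have [h hB fh] := proj _ _ f fB fs _ (bimod_hom_id _).
apply: (bimod_section_fs hB) => z.
have /(congr1 (fun g : {linear _ -> _} => g z)) := fh.
by rewrite lincompE.
Qed.

Section Lift.
Variables (tau : {linear Hplus H -> H \ox Hplus H}) (tauP : is_fs_section tau).
Variables X Y : mbimodule (vect_algebra H).
Variables (f : {linear bimod_action X -> bimod_action Y})
  (s : {linear bimod_action Y -> bimod_action X})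
  (g : {linear Hplus H \ox H -> bimod_action Y}).

(** s is only K-linear, but H^+ (x) H is free as a right module, so the values s(g(x (x) 1)) extend
    to a right linear lift of g. [fs_lift] then makes it left linear too. *)
Definition bimod_ext : {linear Hplus H \ox H -> bimod_action X} :=
  lincomp (vract X) (tmap (lincomp s (lincomp g (tensr (Hplus H) (1 : H)))) (linid H)).

Lemma bimod_extE x h : bimod_ext (x \ot h) = vract X (s (g (x \ot 1)) \ot h).
Proof.
rewrite [LHS]lincompE tmapE; congr (vract X (_ \ot _)).
by rewrite [LHS]lincompE; congr (s _); rewrite [LHS]lincompE tensrE.
Qed.

Definition bimod_lift : {linear Hplus H \ox H -> bimod_action X} :=
  @fs_lift _ _ tau (regular_action H) (bimod_action X) bimod_ext.

Lemma bimod_lift_hom : @bimod_hom _ _ (hopf_bimod (Hplus_action H)) X bimod_lift.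
Proof.
apply/bimod_homP; split; first exact:
  (@fs_lift_equivariant _ _ tau tauP (regular_action H) (bimod_action X) bimod_ext).
apply: fs_lift_rmul => z h; tens_elim z => x k.
by rewrite rmul_opE !bimod_extE vractA.
Qed.

Lemma bimod_lift_factor :
  @bimod_hom _ _ X Y f -> (forall y, f (s y) = y) ->
  @bimod_hom _ _ (hopf_bimod (Hplus_action H)) Y g ->
  forall z, f (bimod_lift z) = g z.
Proof.
move=> /bimod_homP [fl fr] fs /bimod_homP [gl gr].
apply: (@fs_lift_factor _ _ tau tauP (regular_action H) (bimod_action X) bimod_ext) => // z.
tens_elim z => x h.
rewrite bimod_extE fr fs -[LHS]gr; congr (g _).
by rewrite [LHS]rmul_opE mul1r.
Qed.

End Lift.

Lemma fs_vect_smooth (tau : {linear Hplus H -> H \ox Hplus H}) :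
  is_fs_section tau -> formally_smooth (vect_algebra H).
Proof.
move=> tauP; apply/(formally_smoothP (hopf_bimod_Omega1 H)) => X Y f fB [s fs] g gB.
exists (@bimod_lift tau X Y s g); first exact: bimod_lift_hom.
apply: linP => z; rewrite [LHS]lincompE.
apply: (@bimod_lift_factor tau tauP X Y f s g) => // y.
have /(congr1 (fun g : {linear _ -> _} => g y)) := fs.
by rewrite lincompE.
Qed.

End VectSmoothness.

(** * Formal smoothness in comodules *)

Section ComodSmoothness.
Variables (K : fieldType) (H : hopfAlgebra K).

(** Forgetting coactions lets the linear lifts be reused, with only their colinearity left to
    check. *)
Definition forget_bimod (X : mbimodule (comod_algebra H)) : mbimodule (vect_algebra H) :=
  @MBimodule (vect_moncat K) (vect_algebra H) (ccar (bcar X))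
    (chlin (lact X)) (chlin (ract X))
    (congr1 (@chlin _ _ _ _) (lactA X)) (congr1 (@chlin _ _ _ _) (lact1 X))
    (congr1 (@chlin _ _ _ _) (ractA X)) (congr1 (@chlin _ _ _ _) (ract1 X))
    (congr1 (@chlin _ _ _ _) (lractA X)).

Lemma forget_bimod_hom (X Y : mbimodule (comod_algebra H))
    (f : comod_hom (bcar X) (bcar Y)) :
  bimod_hom (f : mhom X Y) <->
  @bimod_hom _ _ (forget_bimod X) (forget_bimod Y) (chlin f).
Proof.
split=> [[fl fr]|[fl fr]]; split.
- exact: (congr1 (@chlin _ _ _ _) fl).
- exact: (congr1 (@chlin _ _ _ _) fr).
- by apply: comod_homP; exact: fl.
- by apply: comod_homP; exact: fr.
Qed.

Definition comod_diag (V : action H) :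
    comod_hom (comod_tens (regular_comodule H) (cofree H V)) (cofree H V) :=
  @ComodHom _ _ (comod_tens (regular_comodule H) (cofree H V)) (cofree H V)
    (diag_op V (regular_action H)) (@diag_colin _ _ V).

Definition comod_rmul (V : action H) :
    comod_hom (comod_tens (cofree H V) (regular_comodule H)) (cofree H V) :=
  @ComodHom _ _ (comod_tens (cofree H V) (regular_comodule H)) (cofree H V)
    (rmul_op H V) (@rmul_colin _ _ V).

Definition comod_hopf_bimod (V : action H) : mbimodule (comod_algebra H).
Proof.
pose B := hopf_bimod V.
refine (@MBimodule (comod_moncat H) (comod_algebra H) (cofree H V)
  (comod_diag V) (comod_rmul V) _ _ _ _ _); apply: comod_homP.
- exact: (lactA B).
- exact: (lact1 B).
- exact: (ractA B).
- exact: (ract1 B).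
- exact: (lractA B).
Defined.

Definition comod_kerincl :
    comod_hom (cofree H (Hplus H)) (comod_tens (regular_comodule H) (regular_comodule H)) :=
  @ComodHom _ _ (cofree H (Hplus H)) (comod_tens (regular_comodule H) (regular_comodule H))
    (kerincl (regular_action H)) (@kerincl_colin _ H).

Definition comod_kerproj :
    comod_hom (comod_tens (regular_comodule H) (regular_comodule H)) (cofree H (Hplus H)) :=
  @ComodHom _ _ (comod_tens (regular_comodule H) (regular_comodule H)) (cofree H (Hplus H))
    (kerproj (regular_action H)) (@kerproj_colin _ H).

Lemma comod_hopf_bimod_Omega1 :
  @is_Omega1 _ _ (comod_hopf_bimod (Hplus_action H)) comod_kerincl.
Proof.
have [[mi0 i_univ] il ir] := hopf_bimod_Omega1 H.
split; [split|by apply: comod_homP; exact: il|by apply: comod_homP; exact: ir].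
  by apply: comod_homP; exact: mi0.
move=> Z g mg0.
(* h0 is merely linear and serves to show that g takes values in the image of [kerincl]. The
   colinear factor is [comod_kerproj] after g. *)
have [h0 [ih0 _]] := i_univ _ _ (congr1 (@chlin _ _ _ _) mg0).
have kerinclK_hom (h : comod_hom Z (cofree H (Hplus H))) :
    comod_comp comod_kerproj (comod_comp comod_kerincl h) = h.
  apply: comod_homP; apply: linP => z.
  rewrite [LHS]lincompE.
  rewrite (congr1 (kerproj (regular_action H)) (lincompE (kerincl (regular_action H)) h z)).
  exact: (@kerinclK _ _ (regular_action H) (h z)).
exists (comod_comp comod_kerproj g); split; last first.
  by move=> h <-; exact: kerinclK_hom.
apply: comod_homP; apply: linP => z; rewrite [LHS]lincompE.
have Eg : kerincl (regular_action H) (h0 z) = g z.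
  by have /(congr1 (fun f : {linear _ -> _} => f z)) := ih0; rewrite lincompE.
rewrite -[RHS]Eg; apply: (congr1 (kerincl (regular_action H))); rewrite [LHS]lincompE.
exact: (etrans (congr1 (kerproj (regular_action H)) (esym Eg))
               (@kerinclK _ _ (regular_action H) (h0 z))).
Qed.

Lemma comod_smooth_fs : formally_smooth (comod_algebra H) ->
  exists tau : {linear Hplus H -> H \ox Hplus H}, is_fs_section tau.
Proof.
move/(formally_smoothP comod_hopf_bimod_Omega1) => proj.
pose f : @mhom (comod_moncat H) (comod_hopf_bimod (free_action H (Hplus H)))
    (comod_hopf_bimod (Hplus_action H)) :=
  @ComodHom _ _ (cofree H (H \ox Hplus H)) (cofree H (Hplus H))
    (tmap (Hplus_act H) (linid H)) (cofree_map_colin (Hplus_act H)).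
pose s : @mhom (comod_moncat H) (comod_hopf_bimod (Hplus_action H))
    (comod_hopf_bimod (free_action H (Hplus H))) :=
  @ComodHom _ _ (cofree H (Hplus H)) (cofree H (H \ox Hplus H))
    (tmap (tensl (Hplus H) (1 : H)) (linid H)) (cofree_map_colin _).
have fB : bimod_hom f.
  apply/forget_bimod_hom; exact: (hopf_bimod_map (@Hplus_act_equivariant _ H)).
have fs : has_section f.
  exists s; apply: comod_homP; apply: linP => z.
  by rewrite [LHS]lincompE act_unit_section.
have [h /forget_bimod_hom hB fh] := proj _ _ f fB fs _ (bimod_hom_id _).
apply: (bimod_section_fs hB) => z.
have /(congr1 (@chlin _ _ _ _))/(congr1 (fun g : {linear _ -> _} => g z)) := fh.
by rewrite lincompE.
Qed.

Section Colinear.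
Variables (tau : {linear Hplus H -> H \ox Hplus H}) (X : mbimodule (comod_algebra H)).
Let XH : action H := bimod_action (forget_bimod X).
Let XC : {linear XH -> XH \ox H} := coact (bcar X : comodule H).

(** All factors of [fs_lift] are colinear: tau acts on the coefficients of a cofree comodule, and
    [spread], phi and the left action of X are colinear. *)
Lemma fs_lift_colin (phi : {linear Hplus H \ox H -> XH}) :
  (forall z, XC (phi z) = tmap phi (linid H) (cofree_coact H (Hplus H) z)) ->
  forall z, XC (@fs_lift _ _ tau (regular_action H) XH phi z)
    = tmap (@fs_lift _ _ tau (regular_action H) XH phi) (linid H) (cofree_coact H (Hplus H) z).
Proof.
move=> phiC z; rewrite fs_liftE.
have -> : tmap (@fs_lift _ _ tau (regular_action H) XH phi) (linid H)
        (cofree_coact H (Hplus H) z)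
    = tmap (lincomp aop (tmap (linid H) phi)) (linid H)
       (codiag (regular_comodule H) (cofree H (Hplus H))
         (spread (Hplus H) (regular_action H) (tmap tau (linid H) z))).
  rewrite spread_colin cofree_map_colin !tmap_comp; congr (tmap _ _ _).
    by apply: linP => y; rewrite [LHS]fs_liftE [RHS]lincompE [RHS]lincompE [RHS]lincompE.
  by apply: linP => y; rewrite !lincompE.
move: (spread _ _ _) => u.
rewrite [LHS](chcolin (lact X)); tens_elim u => h w.
rewrite tmapE !codiagE [coact (bcar X) _]phiC /=.
move: (hcomul H h) (cofree_coact _ _ w) => a b.
tens_elim a => a1 a2; tens_elim b => b1 b2.
by rewrite !(tmapE, codiag_mapE) lincompE tmapE.
Qed.

End Colinear.

(** x (x) 1 is coinvariant, hence so is s(g(x (x) 1)), and the right action of X is colinear. *)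
Lemma bimod_ext_colin (X Y : mbimodule (comod_algebra H))
    (s : comod_hom (bcar Y) (bcar X)) (g : comod_hom (cofree H (Hplus H)) (bcar Y)) z :
  coact (bcar X : comodule H) (@bimod_ext _ _ (forget_bimod X) (forget_bimod Y) s g z)
  = tmap (@bimod_ext _ _ (forget_bimod X) (forget_bimod Y) s g) (linid H)
      (cofree_coact H (Hplus H) z).
Proof.
tens_elim z => x h; rewrite bimod_extE [LHS](chcolin (ract X)) [codiag _ _ _]codiagE.
rewrite !chcolin [coact _ (chlin g _)](chcolin g) /=.
rewrite !cofree_coactE hcomul1 tmapE tenslE !tmapE.
move: (hcomul H h) => a; tens_elim a => a1 a2.
by rewrite codiag_mapE !tmapE tenslE mul1r bimod_extE.
Qed.

Lemma fs_comod_smooth (tau : {linear Hplus H -> H \ox Hplus H}) :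
  is_fs_section tau -> formally_smooth (comod_algebra H).
Proof.
move=> tauP; apply/(formally_smoothP comod_hopf_bimod_Omega1).
move=> X Y f /forget_bimod_hom fB [s fs] g /forget_bimod_hom gB.
pose h : @mhom (comod_moncat H) (comod_hopf_bimod (Hplus_action H)) X :=
  @ComodHom _ _ (cofree H (Hplus H)) (bcar X)
    (@bimod_lift _ _ tau (forget_bimod X) (forget_bimod Y) (chlin s) (chlin g))
    (fs_lift_colin tau (bimod_ext_colin s g)).
exists h; first by apply/forget_bimod_hom; exact: (bimod_lift_hom tauP).
apply: comod_homP; apply: linP => z; rewrite [LHS]lincompE.
apply: (@bimod_lift_factor _ _ tau tauP (forget_bimod X) (forget_bimod Y)
  (chlin f) (chlin s) (chlin g)) => // y.
have /(congr1 (@chlin _ _ _ _))/(congr1 (fun g : {linear _ -> _} => g y)) := fs.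
by rewrite lincompE.
Qed.

End ComodSmoothness.

(** * Modules over the ring H *)

Section ActionModule.
Variables (K : fieldType) (H : hopfAlgebra K) (M : action H).

(** A separate name for the carrier, since the same additive group is already a K-module and now
    becomes an H-module. *)
Definition action_module : Type := M.
HB.instance Definition _ := GRing.Zmodule.on action_module.

Definition action_scale (h : H) (x : action_module) : action_module := h |>[M] x.

Lemma action_scaleA h k x : action_scale h (action_scale k x) = action_scale (h * k) x.
Proof. exact: aopA. Qed.
Lemma action_scale1 : left_id 1 action_scale.
Proof. exact: aop1. Qed.
Lemma action_scaleDr : right_distributive action_scale +%R.
Proof. by move=> h x y; rewrite /action_scale tensDr linearD. Qed.
Lemma action_scaleDl x : {morph action_scale^~ x : h k / h + k}.
Proof. by move=> h k; rewrite /action_scale tensDl linearD. Qed.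
HB.instance Definition _ := GRing.Zmodule_isLmodule.Build H action_module
  action_scaleA action_scale1 action_scaleDr action_scaleDl.

Lemma action_moduleZ h (x : action_module) : h *: x = h |>[M] x.
Proof. by []. Qed.

Lemma aop_alg a (x : M) : (a%:A : H) |> x = a *: x.
Proof. by rewrite tensZl linearZZ aop1. Qed.

End ActionModule.

Section Restriction.
Variables (K : fieldType) (H : hopfAlgebra K) (P : lmodType H).

Definition restriction : Type := P.
HB.instance Definition _ := GRing.Zmodule.on restriction.

Definition restriction_scale (a : K) (x : restriction) : restriction :=
  (a%:A : H) *: (x : P).

Lemma restriction_scaleA a b x :
  restriction_scale a (restriction_scale b x) = restriction_scale (a * b) x.
Proof. by rewrite /restriction_scale scalerA -scalerAl mul1r scalerA. Qed.
Lemma restriction_scale1 : left_id 1 restriction_scale.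
Proof. by move=> x; rewrite /restriction_scale !scale1r. Qed.
Lemma restriction_scaleDr : right_distributive restriction_scale +%R.
Proof. by move=> a x y; rewrite /restriction_scale scalerDr. Qed.
Lemma restriction_scaleDl x : {morph restriction_scale^~ x : a b / a + b}.
Proof. by move=> a b; rewrite /restriction_scale !scalerDl. Qed.
HB.instance Definition _ := GRing.Zmodule_isLmodule.Build K restriction
  restriction_scaleA restriction_scale1 restriction_scaleDr restriction_scaleDl.

Lemma restrictionZ a (x : restriction) : a *: x = (a%:A : H) *: (x : P).
Proof. by []. Qed.

Lemma restriction_op_bilin :
  bilin (fun (h : H) (x : restriction) => (h *: (x : P) : restriction)).
Proof.
split=> [x a h k|h a x y] /=.
  by rewrite restrictionZ scalerDl scalerA -scalerAl mul1r.
by rewrite !restrictionZ scalerDr !scalerA -scalerAr mulr1 -scalerAl mul1r.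
Qed.

Definition restriction_action : action H.
Proof.
refine (@Action _ H restriction (tens_lift restriction_op_bilin) _ _) => [h k x|x].
  by rewrite !tens_liftE scalerA.
by rewrite tens_liftE scale1r.
Defined.

Lemma restriction_actionE h (x : restriction) : h |>[restriction_action] x = h *: (x : P).
Proof. exact: tens_liftE. Qed.

End Restriction.

Section RestrictionMap.
Variables (K : fieldType) (H : hopfAlgebra K) (P Q : lmodType H) (f : {linear P -> Q}).

Lemma restriction_map_linear :
  linear (f : restriction P -> restriction Q).
Proof. by move=> a x y; rewrite /= !restrictionZ linearP. Qed.

Definition restriction_map : {linear restriction P -> restriction Q} :=
  linpack restriction_map_linear.

Lemma restriction_mapE x : restriction_map x = f x.
Proof. exact: linpackE. Qed.

Lemma restriction_map_equivariant :
  @equivariant _ _ (restriction_action P) (restriction_action Q) restriction_map.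
Proof.
by move=> h x; rewrite restriction_mapE !restriction_actionE linearZ /= restriction_mapE.
Qed.

End RestrictionMap.

(** * Projectivity of H^+ and heredity *)

Section Projectivity.
Variables (K : fieldType) (H : hopfAlgebra K).

Definition to_Hplus_module (x : Hplus H) : Hplus_module H :=
  @Submodule _ _ (augmentation_ideal H) (submod_val x) (submod_valP x).
Definition of_Hplus_module (x : Hplus_module H) : Hplus H :=
  @Submodule _ _ (augmentation_subspace H) (submod_val x) (submod_valP x).

Lemma to_Hplus_moduleK x : of_Hplus_module (to_Hplus_module x) = x.
Proof. exact: val_inj. Qed.

Lemma of_Hplus_moduleK x : to_Hplus_module (of_Hplus_module x) = x.
Proof. exact: val_inj. Qed.

Lemma to_Hplus_moduleD x y :
  to_Hplus_module (x + y) = to_Hplus_module x + to_Hplus_module y.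
Proof. exact: val_inj. Qed.

Lemma to_Hplus_module_act h x :
  to_Hplus_module (h |>[Hplus_action H] x) = h *: to_Hplus_module x.
Proof. by apply: val_inj; exact: Hplus_actE. Qed.

Lemma to_Hplus_moduleZ (a : K) x :
  to_Hplus_module (a *: x) = (a%:A : H) *: to_Hplus_module x.
Proof. by rewrite -to_Hplus_module_act aop_alg. Qed.

(** Lift the identity through the H-linear surjection H (x) H^+ -> H^+; an H-linear lift is K-linear
    because a acts as a%:A. *)
Lemma projective_fs : projective_module (Hplus_module H) ->
  exists tau : {linear Hplus H -> H \ox Hplus H}, is_fs_section tau.
Proof.
move=> proj; pose F := action_module (free_action H (Hplus H)).
have f_lin : linear (fun z : F => to_Hplus_module (Hplus_act H z)).
  move=> h y z; rewrite linearD to_Hplus_moduleD action_moduleZ.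
  by rewrite Hplus_act_equivariant to_Hplus_module_act.
pose f : {linear F -> Hplus_module H} :=
  HB.pack (fun z : F => to_Hplus_module (Hplus_act H z))
    (GRing.isLinear.Build H F (Hplus_module H) _ _ f_lin).
have [|h fh] := proj F (Hplus_module H) f _ idfun.
  move=> y; exists (1 \ot of_Hplus_module y).
  rewrite -[RHS]of_Hplus_moduleK; congr to_Hplus_module.
  exact: (@aop1 _ _ (Hplus_action H)).
have tau_lin : linear (fun x : Hplus H => h (to_Hplus_module x) : H \ox Hplus H).
  move=> a x y; rewrite to_Hplus_moduleD to_Hplus_moduleZ linearD linearZ /=.
  by rewrite action_moduleZ aop_alg.
have tauE x : linpack tau_lin x = h (to_Hplus_module x) by exact: linpackE.
exists (linpack tau_lin); split=> [k x|x]; rewrite !tauE.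
  by rewrite Hplus_lmul_action free_lmul to_Hplus_module_act linearZ.
by rewrite -[RHS]to_Hplus_moduleK -[X in _ = of_Hplus_module X]fh to_Hplus_moduleK.
Qed.

Section FsProjective.
Variables (tau : {linear Hplus H -> H \ox Hplus H}) (tauP : is_fs_section tau).

(** This is projectivity of the diagonal H^+ (x) M: over a field f has a linear section, and
    [fs_lift] averages its composite with g. *)
Lemma diag_lift (M X Y : action H) (f : {linear X -> Y}) (g : {linear Hplus H \ox M -> Y}) :
  equivariant f -> (forall y, exists x, f x = y) ->
  @equivariant _ _ (diag_action (Hplus_action H) M) Y g ->
  exists2 h : {linear Hplus H \ox M -> X},
    @equivariant _ _ (diag_action (Hplus_action H) M) X h & forall z, f (h z) = g z.
Proof.
move=> fH f_surj gH; have [s fs] := surjective_linear_section f_surj.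
exists (fs_lift tau (lincomp s g)); first exact: fs_lift_equivariant.
by apply: fs_lift_factor => // z; rewrite lincompE fs.
Qed.

Section Submodule.
Variables (P : lmodType H) (S : submodClosed P).
Hypothesis P_proj : projective_module P.
Let Q : lmodType H := quotient_module S.
Let p : {linear P -> Q} := quotient_proj S.
Variables (X Y : lmodType H) (f : {linear X -> Y}) (g : {linear submodule S -> Y}).
Hypothesis f_surj : forall y, exists x, f x = y.

Lemma quotient_proj0 x : p x = 0 -> x \in S.
Proof. by rewrite -(linear0 p) => /quotient_projP; rewrite subr0. Qed.

(* Schanuel: S is a retract of P (+) ker (H (x) Q -> Q), and the second summand is
   H^+ (x) Q with the diagonal action. *)
Lemma submodule_lift : exists h : {linear submodule S -> X}, forall x, f (h x) = g x.
Proof.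
pose F := action_module (free_action H (restriction Q)).
have e_lin : linear (fun u : F => (@aop _ _ (restriction_action Q) u : Q)).
  move=> h u v; rewrite linearD action_moduleZ; congr (_ + _).
  rewrite -[RHS]restriction_actionE.
  by tens_elim u => k y; rewrite /= free_opE (aopA (a := restriction_action Q)).
pose e : {linear F -> Q} :=
  HB.pack (fun u : F => (@aop _ _ (restriction_action Q) u : Q))
    (GRing.isLinear.Build H F Q _ _ e_lin).
(* lam lifts p through e : H (x) Q -> Q. In the other direction t, built from a K-linear section q
   of p, satisfies p o t = e. *)
have [|lam elam] := P_proj (f := e) _ p.
  by move=> y; exists ((1 : H) \ot (y : restriction Q));
  exact: (@aop1 _ _ (restriction_action Q)).
have [q qP] : exists q : {linear restriction Q -> restriction P}, forall y, p (q y) = y.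
  have [|q qP] := @surjective_linear_section _ _ _ (restriction_map p).
    by move=> y; have [x <-] := quotient_proj_surj y; exists x; rewrite restriction_mapE.
  by exists q => y; rewrite -[RHS]qP restriction_mapE.
pose t : {linear H \ox restriction Q -> restriction P} :=
  lincomp (@aop _ _ (restriction_action P)) (tmap (linid H) q).
have tE h y : t (h \ot y) = h *: (q y : P).
  by rewrite [LHS]lincompE tmapE restriction_actionE.
have tH h u : t (h |>[free_action H (restriction Q)] u) = h *: (t u : P).
  rewrite -[RHS]restriction_actionE.
  by tens_elim u => k y; rewrite /= free_opE !tE restriction_actionE scalerA.
have pt u : p (t u) = e u.
  elim/tens_ind: u => [|u v Eu Ev|h y]; first by rewrite !linear0.
    by rewrite [t _]linearD [e _]linearD [p _]linearD Eu Ev.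
  by rewrite tE linearZ qP [RHS]restriction_actionE.
(* Since p(t(lam x)) = p x, the difference lies in S; rho is the component of the retraction on
   P. *)
have rhoS x : x - t (lam x) \in S.
  by apply: quotient_proj0; rewrite linearB pt elam subrr.
have rho_lin : linear (fun x => Submodule (rhoS x)).
  move=> h x y; apply: val_inj; rewrite [RHS]linearP.
  change (h *: x + y - t (lam (h *: x + y))
          = h *: (x - t (lam x)) + (y - t (lam y))); rewrite linearP.
  by rewrite action_moduleZ [t _]linearD tH opprD scalerBr addrACA.
pose rho : {linear P -> submodule S} :=
  HB.pack (fun x => Submodule (rhoS x))
    (GRing.isLinear.Build H P (submodule S) _ _ rho_lin).
have [h1 fh1] := P_proj f_surj (g \o rho).
(* t maps ker e into S, and [kI] parametrises ker e by H^+ (x) Q, where [diag_lift] yields h2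
   lifting g o t. *)
pose kI := kerincl (restriction_action Q).
have kS z : t (kI z) \in S.
  by apply: quotient_proj0; rewrite pt; exact: (@kerincl_act _ _ (restriction_action Q) z).
have g2_lin : linear (fun z => g (Submodule (kS z)) : restriction Y).
  move=> a y z; rewrite restrictionZ -linearP; congr (g _).
  apply: val_inj; rewrite [RHS]linearP.
  change (t (kI (a *: y + z)) = (a%:A : H) *: (t (kI y) : P) + t (kI z)).
  by rewrite !linearP restrictionZ.
have g2E z : linpack g2_lin z = g (Submodule (kS z)) by exact: linpackE.
have [||h2 h2H fh2] := @diag_lift (restriction_action Q) (restriction_action X)
    (restriction_action Y) (restriction_map f) (linpack g2_lin)
    (restriction_map_equivariant f).
- by move=> y; have [x <-] := f_surj y; exists x; rewrite restriction_mapE.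
- move=> h z; rewrite !g2E restriction_actionE.
  have gZ u : h *: g u = g (h *: u) by rewrite linearZ.
  rewrite [RHS]gZ; congr (g _).
  apply: val_inj; rewrite [RHS]linearZ.
  change (t (kI (h |>[diag_action (Hplus_action H) (restriction_action Q)] z))
          = h *: (t (kI z) : P)).
  by rewrite -tH [kI _]kerincl_equivariant.
pose kP := kerproj (restriction_action Q).
have lam0 (x : submodule S) : e (lam (val x)) = 0.
  by rewrite elam -(linear0 p); apply/quotient_projP; rewrite subr0; exact: valP.
(* For x in S, lam x lies in ker e. The two summands lift g(x - t(lam x)) and g(t(lam x)), which add
   up to g x. *)
have h_lin : linear (fun x : submodule S => h1 (val x) + (h2 (kP (lam (val x))) : X)).
  move=> a x y; rewrite !linearP /= action_moduleZ [kP _]linearD.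
  rewrite [X in h2 (X + _)](@kerproj_equivariant _ _ (restriction_action Q)) ?lam0 //.
  rewrite [h2 _]linearD h2H.
  by rewrite restriction_actionE scalerDr addrACA.
pose h : {linear submodule S -> X} :=
  HB.pack (fun x : submodule S => h1 (val x) + (h2 (kP (lam (val x))) : X))
    (GRing.isLinear.Build H (submodule S) X _ _ h_lin).
exists h => x /=.
rewrite linearD fh1 -[f (h2 _)]restriction_mapE fh2 g2E.
have gD u v : g u + g v = g (u + v) by rewrite linearD.
rewrite [LHS]gD; congr (g _); apply: val_inj; rewrite linearD /= [kI _]kerprojK.
by rewrite [aop _]lam0 tens0r subr0 subrK.
Qed.

End Submodule.

(** A linear lift phi of g extends to an H-linear map e on the free module H (x) H^+, and composing
    e with tau gives the lift. *)
Lemma fs_projective : projective_module (Hplus_module H).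
Proof.
move=> X Y f f_surj g.
have g_lin : linear (fun x : Hplus H => g (to_Hplus_module x) : restriction Y).
  by move=> a x y; rewrite to_Hplus_moduleD to_Hplus_moduleZ linearD linearZ.
have [|s fs] := @surjective_linear_section _ _ _ (restriction_map f).
  by move=> y; have [x <-] := f_surj y; exists x; rewrite restriction_mapE.
pose phi := lincomp s (linpack g_lin).
pose e := lincomp (@aop _ _ (restriction_action X)) (tmap (linid H) phi).
have eE h x : e (h \ot x) = h *: (phi x : X).
  by rewrite [LHS]lincompE tmapE restriction_actionE.
have eH h u : e (h |>[free_action H (Hplus H)] u) = h *: (e u : X).
  rewrite -[RHS]restriction_actionE.
  by tens_elim u => k y; rewrite /= free_opE !eE restriction_actionE scalerA.
have h_lin : linear (fun x => e (tau (of_Hplus_module x)) : X).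
  move=> a x y; rewrite -(of_Hplus_moduleK x) -(of_Hplus_moduleK y).
  rewrite -to_Hplus_module_act -to_Hplus_moduleD !to_Hplus_moduleK.
  by rewrite !linearD (tau_equivariant tauP) eH.
pose h : {linear Hplus_module H -> X} :=
  HB.pack (fun x => e (tau (of_Hplus_module x)) : X)
    (GRing.isLinear.Build H (Hplus_module H) X _ _ h_lin).
exists h => x /=.
have fe u : f (e u) = g (to_Hplus_module (Hplus_act H u)).
  elim/tens_ind: u => [|u v Eu Ev|k y].
  - rewrite !linear0 (_ : to_Hplus_module 0 = 0) ?linear0 //.
    by apply: val_inj; rewrite linear0.
  - by rewrite !linearD Eu Ev to_Hplus_moduleD linearD.
  rewrite eE linearZ -[f _]restriction_mapE lincompE fs linpackE.
  by rewrite to_Hplus_module_act linearZ.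
by rewrite fe tauP.2 of_Hplus_moduleK.
Qed.

Lemma fs_hereditary : hereditary H.
Proof. by move=> P S P_proj X Y f f_surj g; exact: submodule_lift. Qed.

End FsProjective.

Lemma regular_projective (R : pzRingType) : projective_module (R^o : lmodType R).
Proof.
move=> X Y f f_surj g; have [x fx] := f_surj (g 1).
have h_lin : linear (fun r : R^o => (r : R) *: x).
  by move=> a r r'; rewrite scalerDl -scalerA.
pose h : {linear R^o -> X} :=
  HB.pack (fun r : R^o => (r : R) *: x) (GRing.isLinear.Build R R^o X _ _ h_lin).
exists h => r /=.
by rewrite linearZ /= fx -linearZ /= /GRing.scale /= mulr1.
Qed.

Lemma hereditary_projective : hereditary H -> projective_module (Hplus_module H).
Proof. by move=> her; apply: her; exact: regular_projective. Qed.

End Projectivity.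

(** * The antipode and integrals *)

Section Antipode.
Variables (K : fieldType) (H : hopfAlgebra K).
Local Notation S := (hantipode H).

(** The antipode is recovered from the inverse twist, so [untwist_equivariant] yields identities for
    S. *)
Lemma counit_left_untwist (M : action H) h m :
  counit_left H M (untwist M (h \ot m)) = S h |> m.
Proof.
rewrite twist_mapE -[in RHS](hcounitl h).
move: (hcomul H h) => a; tens_elim a => a1 a2.
by rewrite tassocE tmapE lincompE tmapE counit_leftE tmapE tunitlE linearZZ tensZl linearZZ.
Qed.

Definition antipode_mul_left (l : H) : {linear H \ox H -> H} :=
  lincomp (tmul H)
    (tmap (lincomp S (linpack ((tmul_bilin H).1 l))) (linid H)).

Lemma antipode_mul_leftE l h k : antipode_mul_left l (h \ot k) = S (h * l) * k.
Proof.
rewrite [LHS]lincompE tmapE tmulE; congr (_ * _).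
by rewrite [LHS]lincompE; congr (S _); exact: linpackE.
Qed.

(** Apply counit (x) id to the untwist of k acting on l (x) 1: computed directly it is S(k1 l) k2,
    while equivariance pulls k out. *)
Lemma antipode_mul_left_comul l k :
  antipode_mul_left l (hcomul H k) = (hcounit H k : K) *: S l.
Proof.
have <- : counit_left H H (untwist (regular_action H)
      (k |>[diag_action (regular_action H) (regular_action H)] (l \ot 1)))
    = (hcounit H k : K) *: S l.
  rewrite untwist_equivariant -[S l]mulr1.
  have -> : S l * 1 = counit_left H H (untwist (regular_action H) (l \ot 1)).
    by rewrite [RHS](@counit_left_untwist (regular_action H)) [RHS]tmulE.
  elim/tens_ind: (untwist _ _) => [|u v Eu Ev|h m].
  - by rewrite !(tens0r, linear0).
  - by rewrite tensDr !linearD Eu Ev.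
  by rewrite /= free_opE !counit_leftE hcounitM scalerA.
rewrite diagE; move: (hcomul H k) => a; tens_elim a => a1 a2.
rewrite diag_opuE [RHS](@counit_left_untwist (regular_action H)).
by rewrite antipode_mul_leftE !tmulE mulr1.
Qed.

(** Evaluate S(h1 k) h2 S(h3) in two ways: collapsing h2 S(h3) gives S(hk), and collapsing S(h1 k)
    h2 gives S(k) S(h). *)
Lemma antipodeM h k : S (h * k) = S k * S h.
Proof.
pose B : {linear (H \ox H) \ox H -> H} :=
  lincomp (tmul H) (tmap (antipode_mul_left k) S).
have BE a l : B (a \ot l) = antipode_mul_left k a * S l.
  by rewrite [LHS]lincompE tmapE tmulE.
transitivity (B (tmap (hcomul H) (linid H) (hcomul H h))).
  rewrite comulAV -{1}(hcounitr h); move: (hcomul H h) => a.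
  elim/tens_ind: a => [|u v Eu Ev|a1 a2].
  - by rewrite !linear0 mul0r linear0.
  - by rewrite !linearD mulrDl linearD Eu Ev.
  rewrite !tmapE tunitrE -scalerAl linearZZ.
  rewrite -[S (a1 * k)]mulr1 scalerAr -hantipoder.
  elim/tens_ind: (hcomul H a2) => [|u v Eu Ev|b1 b2].
  - by rewrite tens0r !linear0 mulr0.
  - by rewrite tensDr !linearD mulrDr Eu Ev.
  by rewrite tassocVE BE antipode_mul_leftE tmapE tmulE mulrA.
rewrite -{2}(hcounitl h); move: (hcomul H h) => a.
elim/tens_ind: a => [|u v Eu Ev|a1 a2].
- by rewrite !linear0 mulr0.
- by rewrite !linearD mulrDr Eu Ev.
by rewrite !tmapE BE antipode_mul_left_comul tunitlE linearZZ -scalerAl scalerAr.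
Qed.

Lemma antipode1 : S 1 = 1.
Proof.
have := hantipodel (1 : H).
by rewrite hcomul1 tmapE tmulE mulr1 hcounit1 scale1r.
Qed.

End Antipode.

Lemma tens_suml (K : fieldType) (U V : lmodType K) I (r : seq I) (F : I -> U) (v : V) :
  (\sum_(i <- r) F i) \ot v = \sum_(i <- r) F i \ot v.
Proof.
by apply: (big_morph (fun u => u \ot v)) => [u u'|]; rewrite (tensDl, tens0l).
Qed.

Lemma tens_sumr (K : fieldType) (U V : lmodType K) I (r : seq I) (F : I -> V) (u : U) :
  u \ot (\sum_(i <- r) F i) = \sum_(i <- r) u \ot F i.
Proof.
by apply: (big_morph (fun v => u \ot v)) => [v v'|]; rewrite (tensDr, tens0r).
Qed.

(** * Left integrals in finite dimension *)

Section Integral.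
Variables (K : fieldType) (H : hopfAlgebra K).
Local Notation S := (hantipode H).

Section FiniteDimensional.
Variables (n : nat) (cf : {linear H -> 'rV[K]_n}) (cg : 'rV[K]_n -> H).
Hypotheses (cfK : cancel cf cg) (cgK : cancel cg cf).

Definition lmul_mx (h : H) : 'M[K]_n := \matrix_(i < n) cf (h * cg (delta_mx 0 i)).

Lemma coord_sum x : x = \sum_i cf x 0 i *: cg (delta_mx 0 i).
Proof.
apply: (can_inj cfK); rewrite linear_sum [LHS]row_sum_delta; apply: eq_bigr => i _.
by rewrite linearZ /= cgK.
Qed.

Lemma lmul_mxE h x : cf x *m lmul_mx h = cf (h * x).
Proof.
rewrite {2}(coord_sum x) mulr_sumr linear_sum mulmx_sum_row; apply: eq_bigr => i _.
by rewrite rowK -scalerAr linearZ.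
Qed.

Lemma lmul_mx_eq h A : (forall x, cf x *m A = cf (h * x)) -> lmul_mx h = A.
Proof.
move=> AP; apply/row_matrixP => i.
by rewrite !rowE -[delta_mx 0 i]cgK AP lmul_mxE.
Qed.

Lemma lmul_mx_linear : linear lmul_mx.
Proof.
move=> a h k; apply: lmul_mx_eq => x.
by rewrite mulmxDr -scalemxAr !lmul_mxE mulrDl -scalerAl linearP.
Qed.

(** Vectors are rows acted on from the right, so the product is reversed; the antipode restores the
    order in [dual_action]. *)
Lemma lmul_mxM h k : lmul_mx (h * k) = lmul_mx k *m lmul_mx h.
Proof. by apply: lmul_mx_eq => x; rewrite mulmxA !lmul_mxE mulrA. Qed.

Lemma lmul_mx1 : lmul_mx 1 = 1%:M.
Proof. by apply: lmul_mx_eq => x; rewrite mulmx1 mul1r. Qed.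

Lemma dual_op_bilin : bilin (fun (h : H) (v : 'cV[K]_n) => lmul_mx (S h) *m v).
Proof.
split=> [v a h k|h a u v] /=; last by rewrite linearP.
by rewrite linearP lmul_mx_linear mulmxDl -scalemxAl.
Qed.

(* A column v stands for the linear form x |-> cf x *m v. *)
Definition dual_action : action H.
Proof.
refine (@Action _ H 'cV[K]_n (tens_lift dual_op_bilin) _ _) => [h k v|v].
  by rewrite !tens_liftE antipodeM lmul_mxM mulmxA.
by rewrite tens_liftE antipode1 lmul_mx1 mul1mx.
Defined.

Lemma dual_actionE h (v : 'cV[K]_n) : h |>[dual_action] v = lmul_mx (S h) *m v.
Proof. exact: tens_liftE. Qed.

(** The identity of H, seen in H tensored with its dual. *)
Definition canonical_tensor : H \ox 'cV[K]_n :=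
  \sum_(i < n) cg (delta_mx 0 i) \ot delta_mx i 0.

(** Both sides represent left multiplication by k as an endomorphism of H, so they share one matrix
    expansion. *)
Lemma canonical_tensor_swap k :
  \sum_(i < n) cg (delta_mx 0 i) \ot (lmul_mx k *m delta_mx i 0)
  = \sum_(i < n) (k * cg (delta_mx 0 i)) \ot (delta_mx i 0 : 'cV[K]_n).
Proof.
transitivity (\sum_(i < n) \sum_(j < n)
    lmul_mx k j i *: (cg (delta_mx 0 i) \ot (delta_mx j 0 : 'cV[K]_n))).
  apply: eq_bigr => i _; rewrite -colE [col i _]matrix_sum_delta tens_sumr.
  by apply: eq_bigr => j _; rewrite big_ord1 tensZr mxE.
rewrite exchange_big; apply: eq_bigr => j _ /=.
rewrite [k * _]coord_sum tens_suml; apply: eq_bigr => i _.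
by rewrite tensZl -lmul_mxE cgK -rowE [row _ _ _ _]mxE.
Qed.

(** The swap moves the action of S(h2) to the first factor, where h1 S(h2) becomes counit(h). *)
Lemma canonical_tensor_invariant h :
  h |>[diag_action (regular_action H) dual_action] canonical_tensor
  = (hcounit H h : K) *: canonical_tensor.
Proof.
rewrite diagE; transitivity (tmul H (tmap (linid H) S (hcomul H h))
   |>[free_action H 'cV[K]_n] canonical_tensor).
  move: (hcomul H h) => a; tens_elim a => a1 a2.
  rewrite /canonical_tensor !tens_sumr !linear_sum tmapE tmulE.
  transitivity (a1 |>[free_action H 'cV[K]_n]
      \sum_(i < n) cg (delta_mx 0 i) \ot (lmul_mx (S a2) *m delta_mx i 0)).
    rewrite tens_sumr linear_sum; apply: eq_bigr => i _.
    by rewrite diag_opuE dual_actionE /= free_opE tmulE.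
  rewrite canonical_tensor_swap tens_sumr linear_sum; apply: eq_bigr => i _.
  by rewrite /= !free_opE mulrA.
by rewrite hantipoder aop_alg.
Qed.

Lemma coord_contract_bilin (j : 'I_n) :
  bilin (fun (x : H) (v : 'cV[K]_n) => v j 0 *: x).
Proof.
split=> [v a x y|x a u v] /=; first by rewrite scalerDr !scalerA mulrC.
by rewrite !mxE scalerDl scalerA.
Qed.

Definition coord_contract (j : 'I_n) : {linear H \ox 'cV[K]_n -> H} :=
  tens_lift (coord_contract_bilin j).

Lemma coord_contractE j x v : coord_contract j (x \ot v) = v j 0 *: x.
Proof. exact: tens_liftE. Qed.

Lemma coord_contract_sum u :
  u = \sum_(j < n) coord_contract j u \ot (delta_mx j 0 : 'cV[K]_n).
Proof.
elim/tens_ind: u => [|u v Eu Ev|x v].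
- by rewrite big1 // => j _; rewrite linear0 tens0l.
- rewrite {1}Eu {1}Ev -big_split; apply: eq_bigr => j _.
  by rewrite linearD tensDl.
rewrite {1}[v]matrix_sum_delta tens_sumr; apply: eq_bigr => j _.
by rewrite big_ord1 coord_contractE tensZl tensZr.
Qed.

Lemma coord_contract_free j h u :
  coord_contract j (h |>[free_action H 'cV[K]_n] u) = h * coord_contract j u.
Proof.
elim/tens_ind: u => [|u v Eu Ev|x v].
- by rewrite tens0r !linear0 mulr0.
- by rewrite tensDr !linearD mulrDr Eu Ev.
by rewrite /= free_opE !coord_contractE scalerAr.
Qed.

(** Untwisting moves the invariant tensor into a free module, n copies of H, where each coordinate
    is an integral. *)
Lemma left_integral_coord :
  exists2 t : H, t != 0 & forall h, h * t = (hcounit H h : K) *: t.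
Proof.
pose w := untwist dual_action canonical_tensor.
have wP h : h |>[free_action H 'cV[K]_n] w = (hcounit H h : K) *: w.
  have := @untwist_equivariant _ _ dual_action h canonical_tensor.
  by rewrite canonical_tensor_invariant linearZZ => <-.
have [/existsP[j wj]|] := boolP [exists j, coord_contract j w != 0].
  exists (coord_contract j w) => // h.
  by rewrite -coord_contract_free wP linearZ.
rewrite negb_exists => /forallP w0.
have {}w0 : w = 0.
  rewrite [w]coord_contract_sum big1 // => j _.
  by have := w0 j; rewrite negbK => /eqP ->; rewrite tens0l.
(* If all coordinates vanished, so would the canonical tensor, then every basis vector, and finally
   1. *)
have z0 : canonical_tensor = 0.
  by rewrite -[LHS](@untwistK _ _ dual_action) -/w w0 linear0.
have cg0 i : cg (delta_mx 0 i) = 0.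
  have := congr1 (coord_contract i) z0; rewrite linear0 => <-.
  rewrite /canonical_tensor linear_sum (bigD1 i) //= coord_contractE mxE !eqxx scale1r.
  rewrite big1 ?addr0 // => j ji.
  by rewrite coord_contractE mxE eq_sym (negPf ji) scale0r.
have /eqP := oner_neq0 H; case; rewrite [LHS]coord_sum big1 // => i _.
by rewrite cg0 scaler0.
Qed.

End FiniteDimensional.

Lemma exists_left_integral : finite_dimensional H ->
  exists2 t : H, t != 0 & forall h, h * t = (hcounit H h : K) *: t.
Proof. by move=> [n [cf [cg cfK cgK]]]; exact: left_integral_coord cfK cgK. Qed.

End Integral.

(** * Sections of the multiplication of H^+ *)

Section Multiplication.
Variables (K : fieldType) (H : hopfAlgebra K).

Section IntegralSpan.
Variables (t : H) (t_neq0 : t != 0).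
Hypothesis tP : forall h, h * t = (hcounit H h : K) *: t.

Definition integral_span_pred : {pred H^o} :=
  [pred x : H^o | `[< exists c : K, x = c *: t >]].

Lemma integral_span_closed : GRing.submod_closed integral_span_pred.
Proof.
split; first by apply/asboolP; exists 0; rewrite scale0r.
move=> a x y /asboolP [c ->] /asboolP [d ->]; apply/asboolP.
exists ((hcounit H a : K) * c + d).
by rewrite scalerDl mulrC -scalerA -tP scalerAr.
Qed.

Let S : submodClosed (H^o : lmodType H) :=
  HB.pack integral_span_pred
    (GRing.isSubmodClosed.Build H H^o integral_span_pred integral_span_closed).

Lemma integral_span_mul (x : H^o) : (x : H) * t \in S.
Proof. by apply/asboolP; exists (hcounit H x); rewrite tP. Qed.

(* Lifting the identity of K t through H -> K t turns t into an integral of counit 1. *)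
Lemma normalized_left_integral : hereditary H ->
  exists2 l : H, forall h, h * l = (hcounit H h : K) *: l & hcounit H l = 1.
Proof.
move=> /(_ _ S (@regular_projective H)) proj.
have f_lin : linear (fun x : H^o => Submodule (integral_span_mul x)).
  move=> a x y; apply: val_inj; rewrite [RHS]linearP.
  change ((a * (x : H) + y) * t = a * (x * t) + y * t).
  by rewrite mulrDl mulrA.
pose f : {linear H^o -> submodule S} :=
  HB.pack (fun x : H^o => Submodule (integral_span_mul x))
    (GRing.isLinear.Build H H^o (submodule S) _ _ f_lin).
have [|h fh] := proj _ _ f _ idfun.
  move=> [y Sy]; have /asboolP [c yc] := Sy.
  by exists (c%:A : H); apply: val_inj; rewrite /= yc -scalerAl mul1r.
pose l : H := h (f 1).
have lP k : k * l = (hcounit H k : K) *: l.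
  have /(congr1 h) : k *: f 1 = ((hcounit H k : K)%:A : H) *: f 1.
    rewrite -!linearZ; apply: val_inj.
    change ((k * 1) * t = ((hcounit H k : K)%:A * 1) * t).
    by rewrite !mulr1 tP -scalerAl mul1r.
  rewrite !linearZ.
  change (k * l = (hcounit H k : K)%:A * l -> k * l = (hcounit H k : K) *: l).
  by rewrite -scalerAl mul1r.
exists l => //.
(* f l = f 1 reads l t = t, while l t = counit(l) t; since t is nonzero, counit(l) = 1. *)
have : l * t = 1 * t := congr1 val (fh (f 1)).
rewrite mul1r tP => /eqP; rewrite -subr_eq0 -{2}[t]scale1r -scalerBl scaler_eq0.
by rewrite (negPf t_neq0) orbF subr_eq0 => /eqP.
Qed.

End IntegralSpan.

(** As counit(l) = 1, minus the projection of l to H^+ is 1 - l, and x l = 0 for x in H^+. *)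
Lemma hereditary_mul_section :
  finite_dimensional H -> hereditary H -> Hplus_mul_has_section H.
Proof.
move=> /exists_left_integral [t t_neq0 tP].
move=> /(normalized_left_integral t_neq0 tP) [l lP el].
exists (tensr (Hplus H) (- Hplus_proj H l)); split=> [h x|x].
  by rewrite !tensrE tmapE.
apply: Hplus_incl_inj; rewrite tensrE Hplus_mulE linearN Hplus_projE el scale1r.
by rewrite opprB mulrBr mulr1 lP counit_Hplus_incl scale0r subr0.
Qed.

(** Including the first factor H^+ into H is left linear and turns the section into an
    fs-section. *)
Lemma mul_section_fs : Hplus_mul_has_section H ->
  exists tau : {linear Hplus H -> H \ox Hplus H}, is_fs_section tau.
Proof.
move=> [s [sH sK]].
exists (lincomp (tmap (Hplus_incl H) (linid _)) s).
have E x : lincomp (tmap (Hplus_incl H) (linid _)) s x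
  = tmap (Hplus_incl H) (linid _) (s x) by exact: lincompE.
split=> [h x|x]; rewrite !E; last by rewrite -[RHS]sK [RHS]lincompE.
rewrite sH; elim/tens_ind: (s x) => [|u v Eu Ev|y z].
- by rewrite !linear0.
- by rewrite !linearD Eu Ev.
by rewrite !tmapE Hplus_lmulE linpackE.
Qed.

End Multiplication.

Theorem proposition5p5 (K : fieldType) (H : hopfAlgebra K) :
  [<-> formally_smooth (vect_algebra H);
       formally_smooth (comod_algebra H);
       projective_module (Hplus_module H);
       exists tau : {linear Hplus H -> H \ox Hplus H}, is_fs_section tau;
       hereditary H]
  /\ (finite_dimensional H ->
      [<-> formally_smooth (vect_algebra H);
           formally_smooth (comod_algebra H);
           projective_module (Hplus_module H);
           exists tau : {linear Hplus H -> H \ox Hplus H}, is_fs_section tau;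
           hereditary H;
           Hplus_mul_has_section H]).
Proof.
have fs_her : (exists tau : {linear Hplus H -> H \ox Hplus H}, is_fs_section tau) ->
    hereditary H by case=> tau /fs_hereditary.
(* The implications form a cycle in the listed order, most of them passing through an fs-section.
   With (f), the arrow from (e) back to (a) is replaced by one through (f). *)
split=> [|fdH]; tfae.
- by move=> /vect_smooth_fs [tau /fs_comod_smooth].
- by move=> /comod_smooth_fs [tau /fs_projective].
- exact: projective_fs.
- exact: fs_her.
- by move=> /hereditary_projective/projective_fs [tau /fs_vect_smooth].
- by move=> /vect_smooth_fs [tau /fs_comod_smooth].
- by move=> /comod_smooth_fs [tau /fs_projective].
- exact: projective_fs.
- exact: fs_her.
- exact: hereditary_mul_section.
- by move=> /mul_section_fs [tau /fs_vect_smooth].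
Qed.
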